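(* There is an algorithm that, given the adjacency list representation of a unit disk graph $G$ with $n$ vertices and $m$ edges (without any geometric representation), outputs in $O(n+m)$ time a dominating set $D$ of $G$ with $|D| \le \frac{44}{9}\,|D^*|$, where $D^*$ is a minimum dominating set of $G$.
   Context: A unit disk graph is a graph whose vertices can be mapped to points in the Euclidean plane so that two vertices are adjacent if and only if the corresponding points are at Euclidean distance at most $1$. A dominating set of a graph $G=(V,E)$ is a set $D\subseteq V$ such that every vertex not in $D$ is adjacent to some vertex of $D$; a minimum dominating set is one of smallest cardinality. *)

(* Defs.v *)
From HB Require Import structures.
From mathcomp Require Import all_boot all_order all_algebra.
From mathcomp Require Import reals.

Set Implicit Arguments.
Unset Strict Implicit.
Unset Printing Implicit Defensive.

Import Order.TTheory GRing.Theory Num.Theory.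

(** Graphs on the vertex set {0, ..., n-1} *)

Definition simple_graph (n : nat) (e : rel 'I_n) : Prop :=
  symmetric e /\ irreflexive e.

Definition num_edges (n : nat) (e : rel 'I_n) : nat :=
  #|[set uv : 'I_n * 'I_n | (uv.1 < uv.2) && e uv.1 uv.2]|.

(* The canonical norm on R * R is the max norm, so the Euclidean distance is
   spelled out. *)
Definition euclidean_dist (R : realType) (p q : R * R) : R :=
  Num.sqrt ((p.1 - q.1) ^+ 2 + (p.2 - q.2) ^+ 2)%R.

(* Distinct vertices may be mapped to the same point. *)
Definition unit_disk_graph (R : realType) (n : nat) (e : rel 'I_n) : Prop :=
  exists pos : 'I_n -> R * R,
    forall u v, u != v -> e u v = (euclidean_dist (pos u) (pos v) <= 1)%R.

Definition dominating (n : nat) (e : rel 'I_n) (D : {set 'I_n}) : Prop :=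
  forall v, v \notin D -> exists2 u, u \in D & e v u.

Definition minimum_dominating (n : nat) (e : rel 'I_n) (D : {set 'I_n}) :
    Prop :=
  dominating e D /\ forall D', dominating e D' -> #|D| <= #|D'|.

(* The neighbours of each vertex are listed once each, in arbitrary order. *)
Definition adjacency_lists (n : nat) (e : rel 'I_n)
    (adj : 'I_n -> seq 'I_n) : Prop :=
  forall v, uniq (adj v) /\ adj v =i e v.

(** Random access machine with bounded words

    Structured programs over registers and a memory, both indexed by natural
    numbers and containing natural numbers. Each primitive instruction and each
    evaluation of a test takes one time unit. All words written are at most W:
    an instruction whose result exceeds W has no execution. Taking W
    proportional to the input size gives words of logarithmic length, and
    memory addresses, being read from registers, are bounded by W as well.
    Subtraction is truncated at 0. *)

Inductive test : Type :=
| TestLt (x y : nat)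
| TestEq (x y : nat).

Inductive prog : Type :=
| Skip
| Const (x k : nat)     (* r_x := k *)
| Move (x y : nat)      (* r_x := r_y *)
| AddReg (x y z : nat)  (* r_x := r_y + r_z *)
| SubReg (x y z : nat)  (* r_x := r_y - r_z *)
| ReadMem (x y : nat)   (* r_x := memory[r_y] *)
| WriteMem (x y : nat)  (* memory[r_x] := r_y *)
| Seq (p q : prog)
| If (b : test) (p q : prog)
| While (b : test) (p : prog).

Record state : Type := State { reg : nat -> nat; memory : nat -> nat }.

Definition upd (f : nat -> nat) (x v : nat) : nat -> nat :=
  fun y => if y == x then v else f y.

Definition set_reg (s : state) (x v : nat) : state :=
  State (upd (reg s) x v) (memory s).

Definition set_mem (s : state) (a v : nat) : state :=
  State (reg s) (upd (memory s) a v).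

Definition test_holds (b : test) (s : state) : bool :=
  match b with
  | TestLt x y => reg s x < reg s y
  | TestEq x y => reg s x == reg s y
  end.

(* [exec W p s t s']: with word bound W, p started in s halts in s' after
   exactly t time units. *)
Inductive exec (W : nat) : prog -> state -> nat -> state -> Prop :=
| exec_skip s : exec W Skip s 1 s
| exec_const s x k : k <= W -> exec W (Const x k) s 1 (set_reg s x k)
| exec_move s x y : reg s y <= W ->
    exec W (Move x y) s 1 (set_reg s x (reg s y))
| exec_add s x y z : reg s y + reg s z <= W ->
    exec W (AddReg x y z) s 1 (set_reg s x (reg s y + reg s z))
| exec_sub s x y z : reg s y - reg s z <= W ->
    exec W (SubReg x y z) s 1 (set_reg s x (reg s y - reg s z))
| exec_read s x y : memory s (reg s y) <= W ->
    exec W (ReadMem x y) s 1 (set_reg s x (memory s (reg s y)))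
| exec_write s x y : reg s y <= W ->
    exec W (WriteMem x y) s 1 (set_mem s (reg s x) (reg s y))
| exec_seq p q s1 t1 s2 t2 s3 :
    exec W p s1 t1 s2 -> exec W q s2 t2 s3 ->
    exec W (Seq p q) s1 (t1 + t2) s3
| exec_if_true b p q s t s' : test_holds b s ->
    exec W p s t s' -> exec W (If b p q) s t.+1 s'
| exec_if_false b p q s t s' : ~~ test_holds b s ->
    exec W q s t s' -> exec W (If b p q) s t.+1 s'
| exec_while_true b p s1 t1 s2 t2 s3 : test_holds b s1 ->
    exec W p s1 t1 s2 -> exec W (While b p) s2 t2 s3 ->
    exec W (While b p) s1 (t1 + t2).+1 s3
| exec_while_false b p s : ~~ test_holds b s ->
    exec W (While b p) s 1 s.

Lemma exec_deterministic (W : nat) (p : prog) (s s1 s2 : state) (t1 t2 : nat) :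
  exec W p s t1 s1 -> exec W p s t2 s2 -> t1 = t2 /\ s1 = s2.
Proof.
move=> H; elim: H t2 s2 => {p s t1 s1}.
- by move=> s t2 s2 H; inversion H.
- by move=> s x k _ t2 s2 H; inversion H.
- by move=> s x y _ t2 s2 H; inversion H.
- by move=> s x y z _ t2 s2 H; inversion H.
- by move=> s x y z _ t2 s2 H; inversion H.
- by move=> s x y _ t2 s2 H; inversion H.
- by move=> s x y _ t2 s2 H; inversion H.
- move=> p q s1 t1 s2 t2 s3 _ IHp _ IHq t s H; inversion H; subst.
  have [? ?] := IHp _ _ ltac:(eassumption); subst.
  by have [-> ->] := IHq _ _ ltac:(eassumption).
- move=> b p q s t s' hb _ IH t2 s2 H; inversion H; subst; last first.
    by match goal with H : is_true (~~ test_holds _ _) |- _ => rewrite hb in H end.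
  by have [-> ->] := IH _ _ ltac:(eassumption).
- move=> b p q s t s' /negP hb _ IH t2 s2 H; inversion H; subst => //.
  by have [-> ->] := IH _ _ ltac:(eassumption).
- move=> b p s1 t1 s2 t2 s3 hb _ IHp _ IHw t s H; inversion H; subst.
    have [? ?] := IHp _ _ ltac:(eassumption); subst.
    by have [-> ->] := IHw _ _ ltac:(eassumption).
  by match goal with H : is_true (~~ test_holds _ _) |- _ => rewrite hb in H end.
- by move=> b p s /negP hb t s2 H; inversion H; subst.
Qed.

(** Input and output

    A list is stored as its length followed by its entries. The input memory
    test_holds n at address 0, the address of the neighbour list of v at address
    1 + v, then the n neighbour lists one after the other, then zeros. *)

Definition list_block (s : seq nat) : seq nat := size s :: s.

Definition adj_block (n : nat) (adj : 'I_n -> seq 'I_n) (v : 'I_n) : seq nat :=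
  list_block [seq val u | u <- adj v].

Definition adj_address (n : nat) (adj : 'I_n -> seq 'I_n) (v : 'I_n) : nat :=
  n.+1 + \sum_(u < n | u < v) size (adj_block adj u).

Definition input_words (n : nat) (adj : 'I_n -> seq 'I_n) : seq nat :=
  n :: [seq adj_address adj v | v <- enum 'I_n]
    ++ flatten [seq adj_block adj v | v <- enum 'I_n].

Definition initial_state (n : nat) (adj : 'I_n -> seq 'I_n) : state :=
  State (fun _ => 0) (nth 0 (input_words adj)).

(* Register 0 test_holds the address of a list enumerating D without repetition. *)
Definition outputs (s : state) (n : nat) (D : {set 'I_n}) : Prop :=
  exists l : seq nat,
    (forall i, i < size (list_block l) ->
       memory s (reg s 0 + i) = nth 0 (list_block l) i) /\
    perm_eq l [seq val v | v <- enum D].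

(* Main.v *)
(* The algorithm starts from a maximal independent set D and performs a constant
   number of sweeps over the vertices. At a vertex c outside D it replaces the
   D-neighbours of c by c and by a greedily chosen independent set A of the
   vertices that became undominated, and undoes this unless D has shrunk.

   Let S be a dominating set and send each vertex of D to a vertex of S in its
   closed neighbourhood. A unit disc contains at most 5 points at mutual distance
   more than 1, so the fibres have at most 5 elements. Suppose that the exchange
   failed at a vertex c of S whose fibre has 5 elements. Then there are 4
   independent vertices b, not dominated by c, whose D-neighbours all lie in the
   fibre of c. Each b charges 1/4 to a vertex u of S dominating it. The fibre of
   u together with the b's of one c charging u is independent, so a fibre of
   5 - k elements leaves room for at most k of them, and at most 35 vertices of D,
   including the fibre of u, are within two steps of u. Summing the charges gives
   a ratio slightly below 44/9. The slack pays for the vertices c near which D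
   changed after c was treated in a sweep: there are few of them in some sweep,
   because every change shrinks D, so a constant number of sweeps suffices.

   An exchange at c costs time proportional to the number of vertices in a ball of
   constant radius about c. A ball is covered by a constant number of cliques, and
   comparing the degrees of the two vertices of each pair at bounded distance
   shows that there are O(n + m) such pairs. *)

Require Import Defs.
From HB Require Import structures.
From mathcomp Require Import all_boot all_order all_algebra.
From mathcomp Require Import reals zify ring lra.

Set Implicit Arguments.
Unset Strict Implicit.
Unset Printing Implicit Defensive.

(** * Independent sets in discs and boxes *)

Section Hexagon.
Import Order.TTheory GRing.Theory Num.Theory.
Local Open Scope ring_scope.
Variable R : realFieldType.

(** Squared length of [a * e1 + b * e2] for unit vectors [e1], [e2] at an angle of 60 degrees. The
    quadrant [0 <= a], [0 <= b] is therefore a sector of 60 degrees. *)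
Definition hex_form (a b : R) : R := a ^+ 2 + a * b + b ^+ 2.

(** If the two coordinate differences have the same sign, the difference is bounded coordinatewise
    by one of the two vectors. Otherwise the mixed term is not positive, and the form is at most the
    square of the larger difference, which is at most one of the coordinates. *)
Lemma hex_form_sector (a b a' b' M : R) :
    0 <= a -> 0 <= b -> 0 <= a' -> 0 <= b' ->
    hex_form a b <= M -> hex_form a' b' <= M ->
  hex_form (a - a') (b - b') <= M.
Proof.
rewrite /hex_form => a0 b0 a'0 b'0 hM hM'.
have [ha|ha] := lerP a a'; have [hb|hb] := lerP b b'.
- by nra.
- by have [?|?] := lerP (a' - a) (b - b'); nra.
- by have [?|?] := lerP (a - a') (b' - b); nra.
- by nra.
Qed.

Lemma hex_form_rot (a b : R) : hex_form (a + b) (- a) = hex_form a b.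
Proof. by rewrite /hex_form; ring. Qed.

Lemma hex_formN (a b : R) : hex_form (- a) (- b) = hex_form a b.
Proof. by rewrite /hex_form; ring. Qed.

(** Outside [hex_front], the four values correspond to the four sectors of 60 degrees that
    remain. *)
Definition hex_sector (a b : R) : bool * bool :=
  (0 <= b, if 0 <= b then 0 <= a + b else 0 <= a).

(** The cone of 120 degrees whose axis is the first coordinate direction. *)
Definition hex_front (a b : R) : bool :=
  (0 <= a) && ((0 <= b) || (0 <= a + b)).

(** Each of the four back sectors is carried into the quadrant of [hex_form_sector] by a linear
    isometry of the form. *)
Lemma hex_form_back (a b a' b' M : R) :
    ~~ hex_front a b -> ~~ hex_front a' b' ->
    hex_sector a b = hex_sector a' b' ->
    hex_form a b <= M -> hex_form a' b' <= M ->
  hex_form (a - a') (b - b') <= M.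
Proof.
move=> nf nf' [].
move: nf nf'; rewrite /hex_front.
have rot x y : hex_form (- x - y) x = hex_form x y by rewrite /hex_form; ring.
have rot' x y : hex_form y (- x - y) = hex_form x y by rewrite /hex_form; ring.
case: (leP 0 b) => hb; case: (leP 0 b') => hb' //.
- rewrite !orTb !andbT -!ltNge => ha ha' _.
  case: (leP 0 (a + b)) => hs; case: (leP 0 (a' + b')) => hs' // _ h h'.
    rewrite -hex_form_rot; have -> : a - a' + (b - b') = (a + b) - (a' + b') by ring.
    have -> : - (a - a') = - a - - a' by ring.
    by apply: hex_form_sector; rewrite ?hex_form_rot //; lra.
  rewrite -rot'; have -> : - (a - a') - (b - b') = (- a - b) - (- a' - b') by ring.
  by apply: hex_form_sector; rewrite ?rot' //; lra.
- case: (leP 0 a) => ha; case: (leP 0 a') => ha' //=.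
    rewrite -!ltNge => hs hs' _ _ h h'.
    rewrite -rot; have -> : - (a - a') - (b - b') = (- a - b) - (- a' - b') by ring.
    by apply: hex_form_sector; rewrite ?rot //; lra.
  move=> _ _ _ _ h h'.
  rewrite -hex_formN; have -> : - (a - a') = - a - - a' by ring.
  have -> : - (b - b') = - b - - b' by ring.
  by apply: hex_form_sector; rewrite ?hex_formN //; lra.
Qed.

(** The vector [(r, 0)] lies on the common edge of the two sectors that make up the front cone, so
    it shares a sector with any vector of that cone. *)
Lemma hex_form_frontr (r a b M : R) :
    0 <= r -> hex_front a b -> r ^+ 2 <= M -> hex_form a b <= M ->
  hex_form (r - a) (0 - b) <= M.
Proof.
move=> r0 /andP[a0 /orP[b0|s0]] rM h.
  by apply: hex_form_sector => //; rewrite /hex_form; nra.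
have [b0|b0] := leP 0 b.
  by apply: hex_form_sector => //; rewrite /hex_form; nra.
have rot x y : hex_form (- y) (x + y) = hex_form x y by rewrite /hex_form; ring.
rewrite -rot; have -> : - (0 - b) = 0 - - b by ring.
have -> : r - a + (0 - b) = r - (a + b) by ring.
by apply: hex_form_sector; rewrite ?rot //; rewrite /hex_form; nra.
Qed.

End Hexagon.

(** * Packing bounds for unit disk graphs *)

Section Geometry.
Import Order.TTheory GRing.Theory Num.Theory.
Variables (R : realType) (n : nat) (e : rel 'I_n) (pos : 'I_n -> R * R).
Hypothesis e_pos : forall u v, u != v ->
  e u v = (euclidean_dist (pos u) (pos v) <= 1)%R.
Local Open Scope ring_scope.

Definition nbc (u v : 'I_n) : bool := (u == v) || e u v.

Definition indep (S : {set 'I_n}) : Prop := {in S &, forall u v, nbc u v -> u = v}.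

Lemma nbcE u v :
  nbc u v = (((pos u).1 - (pos v).1) ^+ 2 + ((pos u).2 - (pos v).2) ^+ 2 <= 1).
Proof.
rewrite /nbc; case: eqVneq => [->|uv] /=.
  by rewrite !subrr expr0n /= addr0 ler01.
rewrite e_pos // /euclidean_dist -{1}sqrtr1 ler_sqrt //.
Qed.

(** Fix [p] in [S] and let the first axis point from [u] to [p]. A further point in the front cone
    would be within distance 1 of [p], and each of the four back sectors holds at most one point,
    which gives 1 + 4. Six sectors in arbitrary position would only give 6. *)
Lemma indep_disc (u : 'I_n) (S : {set 'I_n}) :
  indep S -> (forall v, v \in S -> nbc u v) -> (#|S| <= 5)%N.
Proof.
move=> iS uS; have [->|[p pS]] := set_0Vmem S; first by rewrite cards0.
rewrite (cardsD1 p) pS add1n ltnS.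
pose X v := (pos v).1 - (pos u).1; pose Y v := (pos v).2 - (pos u).2.
pose c := Num.sqrt (3%:R : R).
have c2 : c ^+ 2 = 3%:R by rewrite sqr_sqrtr.
have c0 : 0 <= c by rewrite sqrtr_ge0.
(* [D] and [K] are the scalar and cross products with [p], that is, coordinates along and across [p]
   scaled by its length. In the hexagonal coordinates [a], [b] the form is [3 * r2] times the
   squared distance; the scaling avoids a division by [r2], which may vanish. *)
pose D v := X p * X v + Y p * Y v; pose K v := X p * Y v - Y p * X v.
pose a v := c * D v - K v; pose b v := 2%:R * K v.
pose r2 := X p ^+ 2 + Y p ^+ 2.
have formE v w : hex_form (a v - a w) (b v - b w) =
    3%:R * r2 * ((X v - X w) ^+ 2 + (Y v - Y w) ^+ 2).
  have -> : hex_form (a v - a w) (b v - b w) =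
     c ^+ 2 * (D v - D w) ^+ 2 + 3%:R * (K v - K w) ^+ 2.
    by rewrite /hex_form /a /b; ring.
  by rewrite c2 /D /K /r2; ring.
have formE0 v : hex_form (a v) (b v) = 3%:R * r2 * (X v ^+ 2 + Y v ^+ 2).
  have -> : hex_form (a v) (b v) = c ^+ 2 * (D v) ^+ 2 + 3%:R * (K v) ^+ 2.
    by rewrite /hex_form /a /b; ring.
  by rewrite c2 /D /K /r2; ring.
have le1 v : v \in S -> X v ^+ 2 + Y v ^+ 2 <= 1.
  move=> /uS; rewrite nbcE => h; apply: le_trans h; rewrite /X /Y.
  by rewrite le_eqVlt; apply/orP; left; apply/eqP; ring.
have r21 : r2 <= 1 by apply: le1.
have r20 : 0 <= r2 by rewrite addr_ge0 ?sqr_ge0.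
have far v w : v \in S -> w \in S -> v != w -> hex_form (a v - a w) (b v - b w) <= 3%:R * r2 ->
    False.
  move=> vS wS vw; rewrite formE; have := iS _ _ vS wS.
  rewrite nbcE => h hh; suff : v = w by apply/eqP.
  apply: h; have -> : (pos v).1 - (pos w).1 = X v - X w by rewrite /X; ring.
  have -> : (pos v).2 - (pos w).2 = Y v - Y w by rewrite /Y; ring.
  have [r0|r0] := ltP 0 r2; first by rewrite -(ler_pM2l r0); nra.
  (* If r2 = 0, then p is at the centre of the disc, so S = {p}. *)
  have z : r2 = 0 by apply: le_anti; rewrite r0 r20.
  have := sqr_ge0 (X p); have := sqr_ge0 (Y p) => y2 x2.
  have /eqP : X p ^+ 2 = 0 by move: z; rewrite /r2; lra.
  have /eqP : Y p ^+ 2 = 0 by move: z; rewrite /r2; lra.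
  rewrite !sqrf_eq0 => /eqP Yp /eqP Xp.
  have pE x : x \in S -> x = p.
    move=> xS; apply: iS => //; rewrite nbcE.
    have := le1 _ xS.
    have -> : (pos x).1 - (pos p).1 = X x - X p by rewrite /X; ring.
    have -> : (pos x).2 - (pos p).2 = Y x - Y p by rewrite /Y; ring.
    by rewrite Xp Yp !subr0.
  by move: vw; rewrite (pE _ vS) (pE _ wS) eqxx.
have hM v : v \in S -> hex_form (a v) (b v) <= 3%:R * r2.
  by move=> vS; rewrite formE0; have := le1 _ vS; nra.
have back v : v \in S :\ p -> ~~ hex_front (a v) (b v).
  rewrite !inE => /andP[vp vS]; apply/negP => fr.
  apply: (far p v pS vS); first by rewrite eq_sym.
  have ap : a p = c * r2 by rewrite /a /D /K /r2; ring.
  have -> : b p = 0 by rewrite /b /K; ring.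
  rewrite ap; apply: hex_form_frontr => //; first by rewrite mulr_ge0.
    by rewrite exprMn c2; nra.
  exact: hM.
have inj : {in S :\ p &, injective (fun v => hex_sector (a v) (b v))}.
  move=> v w vS wS eq; apply/eqP; case: eqVneq => // vw.
  have vS' : v \in S by move: vS; rewrite !inE => /andP[].
  have wS' : w \in S by move: wS; rewrite !inE => /andP[].
  case: (far v w vS' wS' vw); apply: hex_form_back => //; auto.
by rewrite -(card_in_imset inj) (leq_trans (max_card _)) // card_prod card_bool.
Qed.

(** Boxes of the maximum norm are used instead of discs because their radii add along a path and
    they split into square cells. *)
Definition in_box (k : nat) (u v : 'I_n) : bool :=
  (`|(pos u).1 - (pos v).1| <= k%:R) && (`|(pos u).2 - (pos v).2| <= k%:R).

Lemma nbc_sym : symmetric nbc.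
Proof. by move=> u v; rewrite !nbcE -sqrrN opprB -[X in _ + X]sqrrN opprB. Qed.

Lemma in_box_sym k : symmetric (in_box k).
Proof. by move=> u v; rewrite /in_box distrC [X in _ && (X <= _)]distrC. Qed.

Lemma in_boxD j k u v w : in_box j u v -> in_box k v w -> in_box (j + k) u w.
Proof.
move=> /andP[h1 h2] /andP[h3 h4]; rewrite /in_box natrD.
by apply/andP; split; apply: le_trans (ler_distD _ _ _) (lerD _ _);
  eassumption.
Qed.

Lemma in_box_nbc u v : nbc u v -> in_box 1 u v.
Proof.
rewrite nbcE /in_box; set X := (_ - _); set Y := (_ - _) => h.
have := sqr_ge0 X; have := sqr_ge0 Y => y2 x2.
have bound (x : R) : x ^+ 2 <= 1 -> `|x| <= 1.
  by rewrite -[x ^+ 2]real_normK ?num_real // expr_le1.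
by apply/andP; split; apply: bound; lra.
Qed.

(* Cells are squares of side 7/10, whose diagonal is shorter than 1. *)
Definition cell (k : nat) (u v : 'I_n) : 'I_((3 * k).-1.+1) * 'I_((3 * k).-1.+1) :=
  (inord (Num.truncn (((pos v).1 - (pos u).1 + k%:R) * (10%:R / 7%:R))),
   inord (Num.truncn (((pos v).2 - (pos u).2 + k%:R) * (10%:R / 7%:R)))).

(** A side of length [2 * k] meets at most [3 * k] intervals of length 7/10, since 20/7 < 3. *)
Lemma cell_coord (k : nat) (x : R) : (0 < k)%N -> `|x| <= k%:R ->
  let y := (x + k%:R) * (10%:R / 7%:R) in
  0 <= y /\ (Num.truncn y < (3 * k).-1.+1)%N.
Proof.
move=> k0 hx y; move: hx; rewrite ler_norml => /andP[h1 h2].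
have y0 : 0 <= y by rewrite /y; lra.
split=> //; rewrite prednK ?muln_gt0 // -(ltr_nat R).
have /andP[ty _] := truncn_itv y0; apply: le_lt_trans ty _; rewrite natrM /y.
have : 0 < k%:R :> R by rewrite ltr0n.
by lra.
Qed.

Lemma cell_eq k u v w : (0 < k)%N -> in_box k u v -> in_box k u w ->
  cell k u v = cell k u w -> nbc v w.
Proof.
move=> k0; rewrite !(in_box_sym k u) => /andP[v1 v2] /andP[w1 w2].
have [y1 t1] := cell_coord k0 v1; have [y2 t2] := cell_coord k0 v2.
have [y3 t3] := cell_coord k0 w1; have [y4 t4] := cell_coord k0 w2.
have close (a b : R) : 0 <= a * (10%:R / 7%:R) -> 0 <= b * (10%:R / 7%:R) ->
    Num.truncn (a * (10%:R / 7%:R)) = Num.truncn (b * (10%:R / 7%:R)) ->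
    - (7%:R / 10%:R) <= a - b <= 7%:R / 10%:R.
  move=> /truncn_itv /andP[l1 r1] /truncn_itv /andP[l2 r2] eq.
  move: l1 r1 r2; rewrite eq -(natr1 (Num.truncn _)) => l1 r1 r2.
  by apply/andP; split; lra.
case=> /(congr1 val); rewrite /= !inordK // => /(close _ _ y1 y3) /andP[c1 c2].
move=> /(congr1 val); rewrite /= !inordK // => /(close _ _ y2 y4) /andP[c3 c4].
by rewrite nbcE; nra.
Qed.

(** Two steps stay in the box of radius 2, which has 6 * 6 cells, each holding at most one element
    of [S]. One corner cell is out of reach, which lowers 36 to 35; the weights of the charging
    argument depend on this. *)
Lemma indep_two_steps u S : indep S ->
  (forall v, v \in S -> exists w, nbc u w /\ nbc w v) -> (#|S| <= 35)%N.
Proof.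
move=> iS uS.
have box v : v \in S -> in_box 2 u v.
  by move=> /uS[w [h1 h2]]; apply: (in_boxD (in_box_nbc h1) (in_box_nbc h2)).
have inj : {in S &, injective (cell 2 u)}.
  by move=> v w vS wS /(@cell_eq 2 _ _ _ isT (box _ vS) (box _ wS)); apply: iS.
rewrite -(card_in_imset inj).
(* In the last cell both offsets from [u] are at least 5 * 7/10 - 2 = 3/2, so their sum is at least
   3. One step raises the sum of the offsets by at most the square root of 2, which is less than
   3/2. *)
have sub : cell 2 u @: S \subset [set~ (ord_max, ord_max)].
  apply/subsetP => _ /imsetP[v vS ->]; rewrite !inE; apply/eqP.
  have := box _ vS; rewrite in_box_sym => /andP[v1 v2].
  have [y1 t1] := @cell_coord 2 _ isT v1; have [y2 t2] := @cell_coord 2 _ isT v2.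
  case=> /(congr1 val); rewrite /= !inordK // => e1.
  move=> /(congr1 val); rewrite /= !inordK // => e2.
  have /andP[+ _] := truncn_itv y1; rewrite e1 => l1.
  have /andP[+ _] := truncn_itv y2; rewrite e2 => l2.
  have [w [h1 h2]] := uS _ vS.
  have diag x y : nbc x y ->
      (pos y).1 - (pos x).1 + ((pos y).2 - (pos x).2) < 3%:R / 2%:R.
    rewrite nbc_sym nbcE; set X := (_ - _); set Y := (_ - _) => h.
    rewrite ltNge; apply/negP => h'.
    have := sqr_ge0 (X - Y); have := sqr_ge0 (X + Y - 3%:R / 2%:R); lra.
  have := diag _ _ h1; have := diag _ _ h2 => *; lra.
rewrite (leq_trans (subset_leq_card sub)) // cardsC1 card_prod !card_ord.
by [].
Qed.

End Geometry.

(** * Charging and sweeps *)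

Section Charging.
Variables (n : nat) (e : rel 'I_n).
Hypothesis e_sym : symmetric e.
Local Notation nb := (nbc e).
Local Notation indep := (indep e).

Lemma nbcC : symmetric nb.
Proof. by move=> u v; rewrite /nbc eq_sym e_sym. Qed.

Lemma nbcc u : nb u u.
Proof. by rewrite /nbc eqxx. Qed.

Definition nbhd (D : {set 'I_n}) (v : 'I_n) : {set 'I_n} := [set d in D | nb v d].

Definition covers (D : {set 'I_n}) : Prop := forall v, exists2 d, d \in D & nb v d.

Lemma dominatingP D : dominating e D <-> covers D.
Proof.
split=> [dD v|cD v vD].
  have [vD|/dD[d dD' vd]] := boolP (v \in D); first by exists v => //; apply: nbcc.
  by exists d => //; rewrite /nbc vd orbT.
have [d dD /orP[/eqP vd|vd]] := cD v; first by rewrite vd dD in vD.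
by exists d.
Qed.

(* Exchanging the neighbours of c in D for c leaves A undominated, and A is too
   large for the exchange followed by the insertion of A to shrink D. *)
Definition irreducible_at (D : {set 'I_n}) (c : 'I_n) : Prop :=
  c \in D \/ exists A : {set 'I_n},
    [/\ indep A,
        forall a, a \in A -> [/\ a \notin D, ~~ nb c a &
          forall d, d \in D -> nb a d -> nb c d],
        forall a, a \in A -> exists2 d, nb c d & nb d a
      & #|nbhd D c| <= #|A|.+1].

Hypothesis nb_indep5 : forall u S, indep S -> (forall v, v \in S -> nb u v) ->
  #|S| <= 5.
Hypothesis nb_indep35 : forall u S, indep S ->
  (forall v, v \in S -> exists w, nb u w /\ nb w v) -> #|S| <= 35.

Lemma card_nbhd D v : indep D -> #|nbhd D v| <= 5.
Proof.
move=> iD; apply: (nb_indep5 (u := v)) => [x y|x]; rewrite !inE.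
  by move=> /andP[xD _] /andP[yD _]; apply: iD.
by case/andP.
Qed.

Definition proj (S : {set 'I_n}) (v : 'I_n) : 'I_n :=
  odflt v [pick u in S | nb v u].

Lemma projP S v : covers S -> proj S v \in S /\ nb v (proj S v).
Proof.
move=> cS; rewrite /proj; case: pickP => [u /andP[]|h] //.
by have [u uS vu] := cS v; have := h u; rewrite uS vu.
Qed.

Definition fiber (D S : {set 'I_n}) (u : 'I_n) := [set d in D | proj S d == u].

Section Counting.
Variables D S : {set 'I_n}.
Hypotheses (iD : indep D) (cD : covers D) (cS : covers S).
Local Notation F := [set u in S | #|fiber D S u| == 5].

Lemma fiber_sub u : fiber D S u \subset nbhd D u.
Proof.
apply/subsetP => d; rewrite !inE => /andP[-> /eqP <-] /=.
by rewrite nbcC; case: (projP d cS).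
Qed.

Lemma card_fiber u : #|fiber D S u| <= 5.
Proof. exact: leq_trans (subset_leq_card (fiber_sub u)) (card_nbhd u iD). Qed.

(** The fibre lies in the neighbourhood and already has the maximal size 5. *)
Lemma full_nbhd c : c \in F -> nbhd D c = fiber D S c.
Proof.
rewrite inE => /andP[_ /eqP c5]; apply/esym/eqP.
by rewrite eqEcard fiber_sub c5 card_nbhd.
Qed.

Lemma full_notin c : c \in F -> c \notin D.
Proof.
move=> cF; apply/negP => cD'; have := full_nbhd cF.
move: (cF); rewrite inE => /andP[_ /eqP c5] h.
suff : #|nbhd D c| <= 1 by rewrite h c5.
rewrite (leq_trans (subset_leq_card (_ : _ \subset [set c]))) ?cards1 //.
by apply/subsetP => d; rewrite !inE => /andP[dD cd]; apply/eqP/esym/iD.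
Qed.

(** If [c] and [c'] were adjacent, [c'] together with the fibre of [c] would be six independent
    vertices around [c]: by [full_nbhd], the only vertices of [D] close to [c'] are those of its own
    fibre. *)
Lemma full_indep : indep F.
Proof.
move=> c c' cF c'F cc'; apply/eqP; apply: contraT => ne.
suff : #|c' |: fiber D S c| <= 5.
  rewrite cardsU1; move: (cF) (full_notin c'F); rewrite !inE.
  by move=> /andP[_ /eqP ->] /negPf ->.
have cfib d : d \in fiber D S c -> nb c' d -> False.
  rewrite inE => /andP[dD /eqP pd] cd.
  have : d \in nbhd D c' by rewrite inE dD.
  rewrite (full_nbhd c'F) inE dD pd /= => /eqP eq.
  by rewrite eq eqxx in ne.
apply: (nb_indep5 (u := c)) => [x y|x].
  rewrite !in_setU1 => /orP[/eqP->|xf] /orP[/eqP->|yf] //.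
  - by move=> /(cfib _ yf).
  - by rewrite nbcC => /(cfib _ xf).
  - by move: xf yf; rewrite !inE => /andP[xD _] /andP[yD _]; apply: iD.
rewrite in_setU1 => /orP[/eqP->//|xf].
by have := subsetP (fiber_sub c) _ xf; rewrite inE => /andP[].
Qed.

Lemma sum_fiber (B : {set 'I_n}) : \sum_(u in S) #|[set b in B | proj S b == u]| = #|B|.
Proof.
rewrite -[RHS]sum1_card [RHS](partition_big (proj S) (mem S)) /=.
  apply: eq_bigr => u _; rewrite -sum1_card.
  by apply: eq_bigl => b; rewrite inE.
by move=> b _; case: (projP b cS).
Qed.

(** Each [c] in [G] emits at least four charges, one for every element of its set [B c], and [a c u]
    counts those received by [u]. A weighted inequality at each [u] in [S] is summed over [S]. *)
Lemma charging_inequality (G : {set 'I_n}) : G \subset F ->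
    (forall c, c \in G -> irreducible_at D c) ->
  179 * #|D| <= 875 * #|S| + 20 * #|F :\: G|.
Proof.
move=> GF irrG.
have /fin_all_exists[B BP] c : exists A : {set 'I_n}, c \in G ->
    [/\ indep A, forall a, a \in A -> [/\ a \notin D, ~~ nb c a &
          forall d, d \in D -> nb a d -> nb c d] & 4 <= #|A|].
  have [cG|] := boolP (c \in G); last by exists set0.
  have cF := subsetP GF _ cG; case: (irrG _ cG) => [cD'|[A [iA h1 _ h3]]].
    by rewrite (negPf (full_notin cF)) in cD'.
  exists A => _; split=> //.
  by move: h3; rewrite full_nbhd //; move: cF; rewrite inE => /andP[_ /eqP ->].
pose a c u := #|[set b in B c | proj S b == u]|.
(* For [u] different from [c], the vertices of [B c] charging [u] have all their [D]-neighbours in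
   the fibre of [c], so they are independent of the fibre of [u], and the union lies around [u]. No
   vertex of [B c] charges [c] itself. *)
have aA c u : c \in G -> a c u + #|fiber D S u| <= 5.
  move=> cG; have cF := subsetP GF _ cG; have [iB BD _] := BP c cG.
  have [->|uc] := eqVneq u c.
    rewrite (_ : a c c = 0) ?card_fiber //; apply/eqP; rewrite cards_eq0.
    apply/eqP/setP => b; rewrite !inE; apply/negP => /andP[bB /eqP bc].
    have [_ cb _] := BD b bB; have [_] := projP b cS.
    by rewrite bc nbcC (negPf cb).
  have /eqP <- : #|[set b in B c | proj S b == u] :|: fiber D S u| ==
      a c u + #|fiber D S u|.
    rewrite cardsU -/(a c u) (_ : _ :&: _ = set0) ?cards0 ?subn0 //.
    apply/setP => x; rewrite !inE; apply/negP => /andP[/andP[xB _] /andP[xD _]].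
    by have [] := BD x xB; rewrite xD.
  have bd b d : b \in B c -> d \in fiber D S u -> nb b d -> False.
    move=> bB; rewrite inE => /andP[dD /eqP du] bd.
    have [_ _ /(_ d dD bd) cd] := BD b bB.
    have : d \in nbhd D c by rewrite inE dD.
    by rewrite (full_nbhd cF) inE dD du (negPf uc).
  apply: (nb_indep5 (u := u)) => [x y|x].
    rewrite !in_setU [x \in [set _ in _ | _]]inE [y \in [set _ in _ | _]]inE.
    move=> /orP[/andP[xB _]|xf] /orP[/andP[yB _]|yf].
    - exact: iB.
    - by move=> /(bd _ _ xB yf).
    - by rewrite nbcC => /(bd _ _ yB xf).
    - by move: xf yf; rewrite !inE => /andP[xD _] /andP[yD _]; apply: iD.
  by rewrite !inE => /orP[|] /andP[_ /eqP <-]; rewrite nbcC; case: (projP x cS).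
pose K u := [set c in G | 0 < a c u].
(* Every [c] charging [u] through some [b] is the projection of a vertex [d] of [D] adjacent or
   equal to [b]. This [d] is within two steps of [u] and outside the fibre of [u], so [K u] is no
   larger than the rest of [N]. *)
have KA u : #|K u| + #|fiber D S u| <= 35.
  pose N := [set d in D | [exists w, nb u w && nb w d]].
  have N35 : #|N| <= 35.
    apply: (nb_indep35 (u := u)) => [x y|x].
      by rewrite !inE => /andP[xD _] /andP[yD _]; apply: iD.
    by rewrite inE => /andP[_ /existsP[w /andP[h1 h2]]]; exists w.
  have fN : fiber D S u \subset N.
    apply/subsetP => d df; have := subsetP (fiber_sub u) _ df.
    rewrite !inE => /andP[-> ud] /=; apply/existsP; exists d.
    by rewrite ud nbcc.
  have : #|K u| <= #|N :\: fiber D S u|; last first.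
    by rewrite cardsDS // => h; have := subset_leq_card fN; lia.
  apply: leq_trans (leq_imset_card (proj S) _).
  apply/subset_leq_card/subsetP => c; rewrite inE => /andP[cG].
  have cF := subsetP GF _ cG; have [_ BD _] := BP c cG.
  move=> /card_gt0P[b]; rewrite inE => /andP[bB /eqP bu].
  have [bD cb bN] := BD b bB; have [d dD bd] := cD b.
  have : d \in nbhd D c by rewrite inE dD bN.
  rewrite (full_nbhd cF) inE dD /= => /eqP dc.
  have ub : nb b u by rewrite -bu; case: (projP b cS).
  apply/imsetP; exists d => //; rewrite !inE dD dc /=; apply/andP; split.
    by apply: contraNneq cb => ->; rewrite nbcC.
  by apply/existsP; exists b; rewrite nbcC ub.
have sum_a u : \sum_(c in G) a c u <= (35 - #|fiber D S u|) * (5 - #|fiber D S u|).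
  rewrite (bigID (fun c => 0 < a c u)) /= [X in _ + X]big1 ?addn0; last first.
    by move=> c /andP[_]; rewrite -eqn0Ngt => /eqP.
  apply: (@leq_trans (\sum_(c in K u) (5 - #|fiber D S u|))).
    have -> : \sum_(c in G | 0 < a c u) a c u = \sum_(c in K u) a c u.
      by apply: eq_bigl => c; rewrite inE.
    by apply: leq_sum => c; rewrite inE => /andP[/(aA _ u)]; lia.
  rewrite sum_nat_const leq_mul // leq_subRL ?(leq_trans (leq_addl _ _) (KA u)) //.
  by rewrite addnC KA.
(* With [f] the size of the fibre, the left side is at most [5 * (35 - f) * (5 - f) + 20 * (f < 5) +
   179 * f]. The weights 5, 20 and 179 make the bound 895 sharp at [f = 0] and at [f = 5]. *)
have per_u u : u \in S ->
    5 * (\sum_(c in G) a c u) + 20 * (u \notin F) + 179 * #|fiber D S u| <= 895.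
  move=> uS; rewrite inE uS /=; have := sum_a u; have := card_fiber u.
  case: #|_| => [|[|[|[|[|[|]]]]]] //= _ h; rewrite ?muln1 ?muln0 ?addn0;
    move: h; set s := (\sum_(_ in _) _) => h; lia.
have : 5 * (\sum_(u in S) \sum_(c in G) a c u) + 20 * (\sum_(u in S) (u \notin F)) +
    179 * (\sum_(u in S) #|fiber D S u|) <= #|S| * 895.
  by rewrite -sum_nat_const !big_distrr -!big_split; apply: leq_sum.
rewrite sum_fiber exchange_big /=.
have -> : \sum_(u in S) (u \notin F) = #|S :\: F|.
  rewrite -sum1_card big_mkcond [RHS]big_mkcond /=; apply: eq_bigr => u _.
  by rewrite in_setD; case: (u \in S); case: (u \in F).
have FS : F \subset S by apply/subsetP => u; rewrite inE => /andP[].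
have := cardsDS FS; have := subset_leq_card FS.
have := cardsDS GF; have := subset_leq_card GF.
have : 4 * #|G| <= \sum_(c in G) \sum_(u in S) a c u.
  rewrite mulnC -sum_nat_const; apply: leq_sum => c cG.
  by rewrite sum_fiber; case: (BP c cG).
set s := (\sum_(c in G) _); set f := #|F|; set g := #|G|.
set fg := #|F :\: G|; set sf := #|S :\: F|.
move: s f g fg sf #|D| #|S| => s f g fg sf d s'.
by clear; lia.
Qed.

End Counting.
End Charging.

(** * Locality of failed exchanges, progress over the sweeps, and the size of balls *)

Section Sweeps.
Variables (n : nat) (e : rel 'I_n) (near : rel 'I_n).
Variables (cellT : finType) (cellof : 'I_n -> 'I_n -> cellT).
Hypothesis e_sym : symmetric e.
Local Notation nb := (nbc e).
Local Notation indep := (indep e).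
Local Notation covers := (covers e).
Local Notation irreducible_at := (irreducible_at e).
Hypothesis nb_indep5 : forall u S, indep S -> (forall v, v \in S -> nb u v) ->
  #|S| <= 5.
Hypothesis nb_indep35 : forall u S, indep S ->
  (forall v, v \in S -> exists w, nb u w /\ nb w v) -> #|S| <= 35.
Hypothesis near_sym : symmetric near.
Hypothesis near3 : forall u v w x, nb u v -> nb v w -> nb w x -> near u x.
Hypothesis near_cell : forall u v w, near u v -> near u w ->
  cellof u v = cellof u w -> nb v w.
Hypothesis card_cell : #|cellT| <= 81.

Lemma indep_near u S : indep S -> (forall v, v \in S -> near u v) -> #|S| <= 81.
Proof.
move=> iS uS; apply: leq_trans card_cell.
have inj : {in S &, injective (cellof u)}.
  by move=> v w vS wS /(near_cell (uS _ vS) (uS _ wS)); apply: iS.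
by rewrite -(card_in_imset inj) max_card.
Qed.

Lemma nb_near u v : nb u v -> near u v.
Proof. by move=> uv; apply: near3 uv (nbcc _ _) (nbcc _ _). Qed.

Lemma near_refl u : near u u.
Proof. exact: nb_near (nbcc _ _). Qed.

(** The witness inspects [D] only along paths from [c] to some [d], on to [a] in [A] and on to a
    [D]-neighbour of [a], hence within three steps of [c]. *)
Lemma irreducible_local (D D' : {set 'I_n}) c :
    (forall x, near c x -> (x \in D) = (x \in D')) ->
  irreducible_at D c -> irreducible_at D' c.
Proof.
move=> eqD [cD|[A [iA h1 h2 h3]]]; first by left; rewrite -eqD // near_refl.
right; exists A; split=> // [a aA|].
  have [aD ca ad] := h1 a aA; have [d cd da] := h2 a aA.
  split=> // [|d' d'D' ad']; first by rewrite -eqD // (near3 cd da (nbcc _ _)).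
  by apply: ad => //; rewrite eqD // (near3 cd da ad').
suff <- : nbhd e D c = nbhd e D' c by [].
apply/setP => d; rewrite !inE; have [/nb_near cd|] := boolP (nb c d).
  by rewrite eqD.
by rewrite !andbF.
Qed.

(* X collects the vertices whose membership in D changed during the sweep. *)
Definition swept (D0 D : {set 'I_n}) (done : pred 'I_n) : Prop :=
  exists X : {set 'I_n}, #|X| + 10 * #|D| <= 10 * #|D0| /\
    forall c, done c -> (exists2 x, x \in X & near c x) \/ irreducible_at D c.

Lemma swept0 D done : (forall c, ~~ done c) -> swept D D done.
Proof. by move=> h; exists set0; rewrite cards0; split=> // c; rewrite (negPf (h c)). Qed.

Lemma swept_keep D0 D (done done' : pred 'I_n) c :
    (forall x, done' x -> x = c \/ done x) ->
  swept D0 D done -> irreducible_at D c -> swept D0 D done'.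
Proof.
by move=> hd [X [hX h]] ic; exists X; split=> // x /hd[->|/h //]; right.
Qed.

(** The loss of at least one vertex of [D] pays for the at most 10 vertices added to [X]. A treated
    vertex near none of them keeps its witness by locality, and [c] itself belongs to [X']. *)
Lemma swept_improve (D0 D D' : {set 'I_n}) (done done' : pred 'I_n) c (X' : {set 'I_n}) :
    (forall x, done' x -> x = c \/ done x) ->
    swept D0 D done -> #|D'| < #|D| -> #|X'| <= 10 -> c \in X' ->
    (forall x, x \notin X' -> (x \in D) = (x \in D')) ->
  swept D0 D' done'.
Proof.
move=> hd [X [hX h]] lt hX' cX' eqD; exists (X :|: X'); split.
  have := (leq_card_setU X X').1; move: hX hX' lt.
  move: #|X| #|X'| #|D| #|D'| #|D0| #|X :|: X'| => x x' d d' d0 u.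
  by clear; lia.
move=> x /hd[->|/h [[y yX xy]|irr]].
- by left; exists c; rewrite ?inE ?cX' ?orbT ?near_refl.
- by left; exists y; rewrite ?inE ?yX.
have [/existsP[y /andP[yX xy]]|/existsPn no] := boolP [exists y, (y \in X') && near x y].
  by left; exists y; rewrite ?inE ?yX ?orbT.
right; apply: irreducible_local irr => y xy; apply: eqD.
by have := no y; rewrite xy andbT.
Qed.

(* The factor 9 * 20 comes from charging_inequality; each of the at most 10 vertices
   changed by an exchange is near at most 81 vertices with a full fibre. *)
Definition change_cost := locked (9 * (20 * (81 * 10))).

(** The charging inequality is applied to the full vertices that are not near a change. Since 44 *
    179 - 9 * 875 = 1, a violation of the ratio leaves a slack of one [#|S|], which must be covered
    by the changes and hence by the decrease from [D0] to [D]. *)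
Lemma swept_ratio D0 D S : indep D -> covers D -> covers S ->
    swept D0 D predT ->
  9 * #|D| <= 44 * #|S| \/ #|S| + change_cost * #|D| <= change_cost * #|D0|.
Proof.
move=> iD cD cS [X [hX h]].
pose F := [set u in S | #|fiber e D S u| == 5].
pose bad := [set c in F | [exists x, (x \in X) && near c x]].
have iF : indep F by apply: full_indep.
(* The full vertices are independent, so at most 81 of them are near a given element of [X]. *)
have hb : #|bad| <= 81 * #|X|.
  have sub : bad \subset \bigcup_(x in X) [set c in F | near x c].
    apply/subsetP => c; rewrite inE => /andP[cF /existsP[x /andP[xX cx]]].
    by apply/bigcupP; exists x => //; rewrite inE cF near_sym.
  apply: leq_trans (subset_leq_card sub) _.
  rewrite mulnC -sum_nat_const.
  elim/big_rec2: _ => [|x k U _ le]; first by rewrite cards0.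
  apply: leq_trans (leq_card_setU _ _) _; apply: leq_add => //.
  apply: (@indep_near x) => [u v|u]; rewrite !in_set.
    by move=> /andP[uF _] /andP[vF _]; apply: iF; rewrite in_set.
  by case/andP.
have GF : F :\: bad \subset F by apply: subsetDl.
have := charging_inequality e_sym nb_indep5 nb_indep35 iD cD cS GF.
rewrite -/F setDDr setDv set0U => charge.
have {charge} : 179 * #|D| <= 875 * #|S| + 20 * #|F :&: bad|.
  apply: charge => c.
  rewrite in_setD => /andP[cb cF]; case: (h c isT) => // -[x xX cx].
  by case/negP: cb; rewrite inE cF; apply/existsP; exists x; rewrite xX.
have : #|F :&: bad| <= #|bad| by rewrite subset_leq_card // subsetIr.
rewrite /change_cost -lock.
move: hb hX; move: #|bad| #|F :&: bad| #|D| #|D0| #|X| #|S| => b b' d d0 x s.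
by clear; lia.
Qed.

(** Potential argument over [t] sweeps: as long as the ratio fails for [S], each sweep lowers
    [change_cost * #|D|] by at least [#|S|], starting from at most [5 * change_cost * #|S|]. The
    alternative is decided for each [S] separately. *)
Definition progress (t : nat) (D : {set 'I_n}) : Prop :=
  forall S, covers S ->
    9 * #|D| <= 44 * #|S| \/ t * #|S| + change_cost * #|D| <= 5 * change_cost * #|S|.

Lemma card_indep_covers D S : indep D -> covers S -> #|D| <= 5 * #|S|.
Proof.
move=> iD cS; rewrite -(sum_fiber cS D) mulnC -sum_nat_const.
by apply: leq_sum => u _; apply: (card_fiber e_sym nb_indep5 iD cS).
Qed.

Lemma progress0 D : indep D -> progress 0 D.
Proof.
move=> iD S cS; right; have := card_indep_covers iD cS.
by rewrite mul0n add0n -mulnA mulnCA leq_mul2l => ->; rewrite orbT.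
Qed.

(** A ratio already reached persists because a sweep never enlarges [D]. Otherwise the inequality of
    [swept_ratio] is added to the one for [D0]. *)
Lemma progressS t D0 D : indep D -> covers D ->
  progress t D0 -> swept D0 D predT -> progress t.+1 D.
Proof.
move=> iD cD pr sw S cS; have [|h1] := swept_ratio iD cD cS sw; first by left.
case: (pr S cS) => [h2|h2].
  left; apply: leq_trans h2; rewrite leq_mul2l /=.
  by case: sw => X [+ _]; move: #|X| #|D| #|D0| => x d d0; clear; lia.
right; rewrite mulSn; move: h1 h2; set k := 5 * _; set u := _ * #|D|.
set w := _ * #|D0|; set y := _ * #|S|; set z := k * _; move: #|S| => s.
by move: u w y z => u w y z; clear; lia.
Qed.

(** After this many sweeps the second alternative forces [D] to be empty, and then the ratio holds
    as well. *)
Lemma progress_ratio D : progress (5 * change_cost) D ->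
  forall S, covers S -> 9 * #|D| <= 44 * #|S|.
Proof.
move=> pr S /pr[//|]; rewrite -[X in _ <= X]addn0 leq_add2l leqn0 muln_eq0.
by rewrite [change_cost == 0]negbTE ?/change_cost -?lock // => /eqP ->; rewrite muln0.
Qed.

Definition closed_nbhd u := [set v | nb u v].
Definition ball u := [set v | near u v].

Lemma sum_ball : \sum_u #|ball u| <= 2 * (81 * \sum_u #|closed_nbhd u|).
Proof.
(* Every near pair is counted from an endpoint of larger degree. The part of [small u] in one cell
   is a clique, hence contained in the closed neighbourhood of any of its members [v], which is no
   larger than that of [u]. *)
pose small u := [set v | near u v && (#|closed_nbhd v| <= #|closed_nbhd u|)].
have small_le u : #|small u| <= 81 * #|closed_nbhd u|.
  rewrite -sum1_card (partition_big (cellof u) predT) //=.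
  apply: (@leq_trans (\sum_(t : cellT) #|closed_nbhd u|)); last first.
    by rewrite sum_nat_const leq_mul2r (leq_trans _ card_cell) ?orbT // max_card.
  apply: leq_sum => t _; rewrite sum1_card.
  have [/pred0P|] := boolP (pred0b [pred v in small u | cellof u v == t]).
    by move=> /eq_card0 ->.
  case/pred0Pn => v /andP[]; rewrite inE => /andP[uv le] /eqP vt.
  apply: leq_trans le; apply/subset_leq_card/subsetP => w /andP[].
  rewrite !inE => /andP[uw _] /eqP wt.
  by apply: near_cell uv uw _; rewrite vt wt.
have -> : \sum_u #|ball u| = \sum_u \sum_v near u v.
  by apply: eq_bigr => u _; rewrite -sum1_card big_mkcond;
     apply: eq_bigr => v _; rewrite inE; case: near.
have smallE u : #|small u| =
    \sum_v (near u v && (#|closed_nbhd v| <= #|closed_nbhd u|)).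
  by rewrite -sum1_card big_mkcond; apply: eq_bigr => v _; rewrite inE; case: (_ && _).
apply: (@leq_trans (\sum_u #|small u| + \sum_u #|small u|)); last first.
  rewrite addnn -mul2n leq_mul2l /= big_distrr /=; exact: leq_sum.
rewrite [X in X + _](eq_bigr _ (fun u _ => smallE u)).
rewrite [X in _ + X](_ : _ = \sum_u \sum_v
    (near u v && (#|closed_nbhd u| <= #|closed_nbhd v|))); last first.
  rewrite [LHS](eq_bigr _ (fun u _ => smallE u)) exchange_big /=.
  by apply: eq_bigr => u _; apply: eq_bigr => v _; rewrite near_sym.
rewrite -big_split; apply: leq_sum => u _; rewrite -big_split; apply: leq_sum => v _.
by case: near => //=; case: (leqP #|closed_nbhd v|) => //= /ltnW ->.
Qed.

End Sweeps.

(** * Programs and the input *)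

Section Runs.
Variable W : nat.

(** Total correctness with time, in continuation style: nested postconditions let a proof follow the
    program instruction by instruction. *)
Definition run (p : prog) (s : state) (Q : nat -> state -> Prop) : Prop :=
  exists t s', exec W p s t s' /\ Q t s'.

Lemma run_conseq p s (Q Q' : nat -> state -> Prop) :
  run p s Q -> (forall t s', Q t s' -> Q' t s') -> run p s Q'.
Proof. by move=> [t [s' [h q]]] h'; exists t, s'; split=> //; apply: h'. Qed.

Lemma run_skip s (Q : nat -> state -> Prop) : Q 1 s -> run Skip s Q.
Proof. by move=> q; exists 1, s; split=> //; constructor. Qed.

Lemma run_const s x k (Q : nat -> state -> Prop) :
  k <= W -> Q 1 (set_reg s x k) -> run (Const x k) s Q.
Proof. by move=> kW q; exists 1, (set_reg s x k); split=> //; constructor. Qed.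

Lemma run_move v s x y (Q : nat -> state -> Prop) :
  reg s y = v -> v <= W -> Q 1 (set_reg s x v) -> run (Move x y) s Q.
Proof. by move=> <- vW q; eexists _, _; split; last exact: q; constructor. Qed.

Lemma run_add v s x y z (Q : nat -> state -> Prop) :
  reg s y + reg s z = v -> v <= W -> Q 1 (set_reg s x v) -> run (AddReg x y z) s Q.
Proof. by move=> <- vW q; eexists _, _; split; last exact: q; constructor. Qed.

Lemma run_sub v s x y z (Q : nat -> state -> Prop) :
  reg s y - reg s z = v -> v <= W -> Q 1 (set_reg s x v) -> run (SubReg x y z) s Q.
Proof. by move=> <- vW q; eexists _, _; split; last exact: q; constructor. Qed.

Lemma run_read v s x y (Q : nat -> state -> Prop) :
  memory s (reg s y) = v -> v <= W -> Q 1 (set_reg s x v) -> run (ReadMem x y) s Q.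
Proof. by move=> <- vW q; eexists _, _; split; last exact: q; constructor. Qed.

Lemma run_write a v s x y (Q : nat -> state -> Prop) :
  reg s x = a -> reg s y = v -> v <= W -> Q 1 (set_mem s a v) ->
  run (WriteMem x y) s Q.
Proof. by move=> <- <- vW q; eexists _, _; split; last exact: q; constructor. Qed.

Lemma run_seq p q s (Q : nat -> state -> Prop) :
  run p s (fun t s' => run q s' (fun t' => Q (t + t'))) -> run (Seq p q) s Q.
Proof.
move=> [t [s1 [h1 [t' [s2 [h2 hQ]]]]]]; exists (t + t'), s2; split=> //.
exact: exec_seq h1 h2.
Qed.

Lemma run_if b p q s (Q : nat -> state -> Prop) :
  (test_holds b s -> run p s (fun t => Q t.+1)) ->
  (~~ test_holds b s -> run q s (fun t => Q t.+1)) ->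
  run (If b p q) s Q.
Proof.
move=> ht hf; have [hb|hb] := boolP (test_holds b s).
  by have [t [s' [h hQ]]] := ht hb; exists t.+1, s'; split=> //; apply: exec_if_true.
by have [t [s' [h hQ]]] := hf hb; exists t.+1, s'; split=> //; apply: exec_if_false.
Qed.

(** The number [N] of iterations is fixed in advance. [J i t] holds after [i] iterations and [t]
    time units; each successor accounts for one evaluation of the test. *)
Lemma run_while (N : nat) (J : nat -> nat -> state -> Prop) b p s :
    J 0 0 s ->
    (forall i t s, i < N -> J i t s ->
       test_holds b s /\ run p s (fun t' s' => J i.+1 (t + t').+1 s')) ->
    (forall t s, J N t s -> ~~ test_holds b s) ->
  run (While b p) s (fun t s' => exists2 t', t = t'.+1 & J N t' s').
Proof.
move=> J0 step stop.
have main k : forall i t s, i + k = N -> J i t s ->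
    run (While b p) s (fun t' s' => exists2 t'', t + t' = t''.+1 & J N t'' s').
  elim: k => [|k IH] i t s0.
    rewrite addn0 => -> Js; exists 1, s0; split; last by exists t; rewrite ?addn1.
    by apply: exec_while_false; apply: stop Js.
  move=> ik Js; have iN : i < N by rewrite -ik -addSnnS leq_addr.
  have [hb [t1 [s1 [h1 J1]]]] := step _ _ _ iN Js.
  have [|t2 [s2 [h2 [t3 e3 J3]]]] := IH _ _ _ _ J1; first by rewrite addSnnS.
  exists (t1 + t2).+1, s2; split; first exact: exec_while_true hb h1 h2.
  by exists t3 => //; rewrite -e3; lia.
by have [t [s' [h1 h2]]] := main N 0 0 s (add0n N) J0; exists t, s'.
Qed.

End Runs.

(** * Layout of the input in memory *)

Section Input.
Variables (n : nat) (adj : 'I_n -> seq 'I_n).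

Definition input_size := size (input_words adj).

Lemma input_sizeE : input_size = n.+1 + \sum_u (size (adj u)).+1.
Proof.
rewrite /input_size /input_words /= size_cat size_map size_enum_ord addSn.
congr (_ + _).+1; rewrite size_flatten /shape -map_comp sumnE big_map big_enum /=.
by apply: eq_bigr => u _; rewrite /= size_map.
Qed.

Lemma input_address (u : 'I_n) : nth 0 (input_words adj) u.+1 = adj_address adj u.
Proof.
rewrite /input_words /= nth_cat size_map size_enum_ord ltn_ord.
by rewrite (nth_map u) ?size_enum_ord // nth_ord_enum.
Qed.

Lemma enum_split (u : 'I_n) :
  enum 'I_n = take u (enum 'I_n) ++ u :: drop u.+1 (enum 'I_n).
Proof.
rewrite -{1}(cat_take_drop u (enum 'I_n)) (drop_nth u) ?size_enum_ord //.
by rewrite nth_ord_enum.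
Qed.

Lemma adj_addressE (u : 'I_n) : adj_address adj u =
  n.+1 + size (flatten [seq adj_block adj v | v <- take u (enum 'I_n)]).
Proof.
rewrite /adj_address size_flatten /shape -map_comp sumnE big_map; congr (_ + _).
transitivity (\sum_(v in 'I_n | v < u) size (adj_block adj v)).
  by apply: eq_bigl => v; rewrite inE.
rewrite -big_enum_cond /= {1}(enum_split u) big_cat big_cons ltnn /=.
rewrite [X in _ + X]big1_seq ?addn0; last first.
  move=> v /andP[vu /(nthP u)[i]]; rewrite size_drop size_enum_ord => hi.
  rewrite nth_drop => /(congr1 val); rewrite /= nth_enum_ord; last by lia.
  by move=> eq; move: vu; rewrite -eq; lia.
rewrite big_seq_cond [RHS]big_seq_cond; apply: eq_bigl => v.
have [/(nthP u)[i]|] //= := boolP (v \in take u (enum 'I_n)).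
have un := ltn_ord u; rewrite size_take size_enum_ord un => hi.
rewrite nth_take // => /(congr1 val); rewrite /= nth_enum_ord; last by lia.
by move=> <-.
Qed.

Lemma input_block (u : 'I_n) j : j <= size (adj u) ->
  nth 0 (input_words adj) (adj_address adj u + j) = nth 0 (adj_block adj u) j.
Proof.
move=> hj; rewrite adj_addressE /input_words addSn addSn /= nth_cat size_map size_enum_ord.
rewrite -addnA ltnNge leq_addr /= addKn {1}(enum_split u) map_cat flatten_cat nth_cat.
rewrite ltnNge leq_addr addKn; case: j hj => [|j] hj //=.
by rewrite nth_cat size_map hj.
Qed.

Lemma adj_address_bound (u : 'I_n) : adj_address adj u + (size (adj u)).+1 <= input_size.
Proof.
rewrite adj_addressE /input_size /input_words /= size_cat size_map size_enum_ord.
rewrite addSn addSn ltnS -addnA leq_add2l {2}(enum_split u) map_cat flatten_cat.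
by rewrite size_cat leq_add2l /= size_cat size_map leq_addr.
Qed.

Lemma adj_address_last (u : 'I_n) : u.+1 = n ->
  adj_address adj u + (size (adj u)).+1 = input_size.
Proof.
move=> un; rewrite adj_addressE /input_size /input_words /= size_cat size_map size_enum_ord.
rewrite addSn addSn -addnA {2}(enum_split u) map_cat flatten_cat.
rewrite size_cat /= size_cat /= size_map drop_oversize ?size_enum_ord ?un //.
by rewrite /= addn0.
Qed.

End Input.

(** * Insertion and removal of vertices *)

(* Registers: 1 to 6 hold 1, n and the base addresses of the membership array,
   the counter array and the two lists of an exchange; 21 holds 0. Register 7 holds
   the current vertex, 8 and 9 the ends of the two lists, 15 the vertex to update.
   The counter of v is the number of vertices of D in the closed neighbourhood of v. *)
Definition const_regs := [:: 1; 2; 3; 4; 5; 6; 21].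

(** The pointer [p] starts at the length cell and is incremented before each read, so [q] is the
    address of the last entry. *)
Definition for_adj (v p q x : nat) (body : prog) : prog :=
  Seq (AddReg p v 1) (Seq (ReadMem p p) (Seq (ReadMem q p) (Seq (AddReg q p q)
    (While (TestLt p q) (Seq (AddReg p p 1) (Seq (ReadMem x p) body)))))).

Definition bump (b : bool) (x : nat) : prog :=
  Seq (AddReg 13 4 x) (Seq (ReadMem 14 13)
    (Seq (if b then AddReg 14 14 1 else SubReg 14 14 1) (WriteMem 13 14))).

Definition update (b : bool) : prog :=
  Seq (AddReg 13 3 15) (Seq (WriteMem 13 (if b then 1 else 21))
    (Seq (bump b 15) (for_adj 15 10 11 12 (bump b 12)))).

Definition update_list (b : bool) : prog :=
  While (TestLt 19 24) (Seq (ReadMem 15 19) (Seq (AddReg 19 19 1) (update b))).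

Section Machine.
Variables (n : nat) (e : rel 'I_n) (adj : 'I_n -> seq 'I_n) (W : nat).
Local Notation L := (input_size adj).
Local Notation deg u := (size (adj u)).
Local Notation addr u := (adj_address adj u).
Local Notation nb := (nbc e).

Definition env (s : state) : Prop :=
  [/\ [/\ reg s 1 = 1, reg s 2 = n, reg s 3 = L & reg s 4 = L + n],
      reg s 5 = L + 2 * n, reg s 6 = L + 3 * n, reg s 21 = 0
    & forall a, a < L -> memory s a = nth 0 (input_words adj) a].

Definition unchanged (rs : seq nat) (s s' : state) : Prop :=
  forall r, r \notin rs -> reg s' r = reg s r.

(** Updates of [D] write only to the membership and counter arrays, so the exchange lists behind
    them survive. *)
Definition same_lists (s s' : state) : Prop :=
  forall a, L + 2 * n <= a -> memory s' a = memory s a.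

Definition represents (s : state) (D : {set 'I_n}) : Prop :=
  (forall v : 'I_n, memory s (L + v) = (v \in D)) /\
  (forall v : 'I_n, memory s (L + n + v) = #|nbhd e D v|).

Lemma reg_set_eq s x v : reg (set_reg s x v) x = v.
Proof. by rewrite /set_reg /upd /= eqxx. Qed.

Lemma reg_set_neq s x y v : y != x -> reg (set_reg s x v) y = reg s y.
Proof. by rewrite /set_reg /upd /= => /negPf ->. Qed.

Lemma env_frame s s' : env s -> (forall r, r \in const_regs -> reg s' r = reg s r) ->
  (forall a, a < L -> memory s' a = memory s a) -> env s'.
Proof.
move=> [[h1 h2 h3 h4] h5 h6 h7 h8] hr hm.
by split; [split|..]; rewrite ?hr // => a ha; rewrite hm // h8.
Qed.

Lemma env_set_reg s x v : env s -> x \notin const_regs -> env (set_reg s x v).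
Proof.
move=> es hx; apply: env_frame es _ _ => // r hr; apply: reg_set_neq.
by apply: contraNneq hx => <-.
Qed.

Lemma env_set_mem s a v : env s -> L <= a -> env (set_mem s a v).
Proof.
move=> es ha; apply: env_frame es _ _ => // b hb.
by rewrite /= /upd; case: eqP => // eq; move: hb; rewrite eq; lia.
Qed.

Lemma addr_bound u : addr u + deg u < L.
Proof. by have := adj_address_bound adj u; lia. Qed.

Lemma n_bound : n <= L.
Proof. by rewrite input_sizeE; lia. Qed.

Lemma env_address s (u : 'I_n) : env s -> memory s u.+1 = addr u.
Proof.
move=> [_ _ _ _ h]; rewrite h ?input_address //.
by have := n_bound; have := ltn_ord u; have := addr_bound u; rewrite /adj_address; lia.
Qed.

Lemma env_degree s u : env s -> memory s (addr u) = deg u.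
Proof.
move=> [_ _ _ _ h]; rewrite h; last by have := addr_bound u; lia.
by rewrite -[addr u]addn0 input_block //= size_map.
Qed.

Lemma env_neighbour s u i : env s -> i < deg u ->
  memory s (addr u + i.+1) = nth u (adj u) i.
Proof.
move=> [_ _ _ _ h] hi; rewrite h; last by have := addr_bound u; lia.
by rewrite input_block //= (nth_map u).
Qed.

Hypothesis e_sym : symmetric e.
Hypothesis e_irr : irreflexive e.
Hypothesis adjP : adjacency_lists e adj.
Hypothesis W_large : L + 4 * n + 2 <= W.

(** The set-up takes 4 time units, and each iteration adds 3 to the body: the test, the increment
    and the read. *)
Lemma run_for_adj (J : nat -> nat -> state -> Prop) v p q x body s (u : 'I_n)
    (Q : nat -> state -> Prop) :
    uniq [:: p; q; x] -> all (fun r => r \notin const_regs) [:: p; q; x] ->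
    env s -> reg s v = u ->
    (forall s', unchanged [:: p; q] s s' -> memory s' = memory s -> J 0 4 s') ->
    (forall i t s1 s2, i < deg u -> J i t s1 -> env s1 ->
       unchanged [:: p; x] s1 s2 -> memory s2 = memory s1 ->
       reg s2 x = nth u (adj u) i -> env s2 ->
       run W body s2 (fun t' s' =>
         [/\ J i.+1 (t + t' + 3) s', reg s' p = reg s2 p, reg s' q = reg s2 q & env s'])) ->
    (forall t s', J (deg u) t s' -> env s' -> Q t.+1 s') ->
  run W (for_adj v p q x body) s Q.
Proof.
move=> upqx /and4P[pc qc xc _] es vu J0 Jstep Jend.
move: upqx; rewrite /= !inE negb_or !andbT => /andP[/andP[pq px] qx].
have [[h1 _ _ _] _ _ _ _] := es.
have hL := addr_bound u; have hn := n_bound; have hu := ltn_ord u.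
apply: run_seq; apply: (run_add (v := u.+1)); first by rewrite vu h1 addn1.
  by lia.
set s1 := set_reg _ _ _.
have es1 : env s1 by apply: env_set_reg.
apply: run_seq; apply: (run_read (v := addr u)); first by rewrite reg_set_eq env_address.
  by lia.
set s2 := set_reg _ _ _; have es2 : env s2 by apply: env_set_reg.
apply: run_seq; apply: (run_read (v := deg u)); first by rewrite reg_set_eq env_degree.
  by lia.
set s3 := set_reg _ _ _; have es3 : env s3 by apply: env_set_reg.
apply: run_seq; apply: (run_add (v := addr u + deg u)).
    by rewrite reg_set_eq reg_set_neq // reg_set_eq.
  by lia.
set s4 := set_reg _ _ _; have es4 : env s4 by apply: env_set_reg.
have un4 : unchanged [:: p; q] s s4.
  move=> r; rewrite !inE negb_or => /andP[rp rq].
  by rewrite /s4 /s3 /s2 /s1 !reg_set_neq.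
have p4 : reg s4 p = addr u + 0.
  by rewrite addn0 /s4 /s3 reg_set_neq // reg_set_neq // reg_set_eq.
have q4 : reg s4 q = addr u + deg u by rewrite reg_set_eq.
pose K i t s' := [/\ J i (t + 4) s', reg s' p = addr u + i,
                     reg s' q = addr u + deg u & env s'].
apply: run_conseq (@run_while W (deg u) K _ _ _ _ _ _) _.
- by split=> //; apply: J0.
- move=> i t s5 hi [Ji pi qi es5]; split; first by rewrite /= pi qi; lia.
  have [[h1' _ _ _] _ _ _ _] := es5.
  apply: run_seq; apply: (run_add (v := addr u + i.+1)); first by rewrite pi h1'; lia.
    by lia.
  set s6 := set_reg _ _ _; have es6 : env s6 by apply: env_set_reg.
  apply: run_seq; apply: (run_read (v := nth u (adj u) i)).
      by rewrite reg_set_eq env_neighbour.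
    by have := ltn_ord (nth u (adj u) i); lia.
  set s7 := set_reg _ _ _; have es7 : env s7 by apply: env_set_reg.
  have un : unchanged [:: p; x] s5 s7.
    by move=> r; rewrite !inE negb_or => /andP[rp rx]; rewrite /s7 /s6 !reg_set_neq.
  apply: run_conseq (Jstep i _ s5 s7 hi Ji es5 un _ _ es7) _ => //.
    by rewrite reg_set_eq.
  move=> t' s' [J' p' q' es']; split=> //.
  + by move: J'; congr J; lia.
  + by rewrite p' /s7 /s6 reg_set_neq // reg_set_eq.
  + by rewrite q' un // !inE negb_or eq_sym pq.
- by move=> t s5 [_ pi qi _]; rewrite /= pi qi ltnn.
move=> t s' [t' -> [J' _ _ es']].
have -> : 1 + (1 + (1 + (1 + t'.+1))) = (t' + 4).+1 by lia.
exact: Jend.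
Qed.

Lemma run_bump b x s (v : 'I_n) g (Q : nat -> state -> Prop) :
    env s -> x \notin [:: 13; 14] -> reg s x = v ->
    memory s (L + n + v) = g -> g < W ->
    (forall s', env s' -> unchanged [:: 13; 14] s s' ->
       (memory s' =1 upd (memory s) (L + n + v) (if b then g.+1 else g.-1)) -> Q 4 s') ->
  run W (bump b x) s Q.
Proof.
move=> es; rewrite !inE negb_or => /andP[x13 x14] xv gE gW hQ.
have [[h1 h2 h3 h4] h5 h6 h7 h8] := es; have hv := ltn_ord v.
apply: run_seq; apply: (run_add (v := L + n + v)); first by rewrite h4 xv.
  by lia.
apply: run_seq; apply: (run_read (v := g)) => //=; first exact: ltnW.
apply: run_seq.
have : run W (if b then AddReg 14 14 1 else SubReg 14 14 1)
    (set_reg (set_reg s 13 (L + n + v)) 14 g)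
    (fun t s' => t = 1 /\ s' = set_reg (set_reg (set_reg s 13 (L + n + v)) 14 g) 14
       (if b then g.+1 else g.-1)).
  case: b {hQ}.
    by apply: (run_add (v := g.+1)) => //=; rewrite /upd /= h1 addn1.
  apply: (run_sub (v := g.-1)) => //=; first by rewrite /upd /= h1 subn1.
  by lia.
move=> h; apply: run_conseq h _ => _ _ [-> ->].
apply: (run_write (a := L + n + v) (v := if b then g.+1 else g.-1)) => //=.
  by case: b {hQ}; lia.
apply: hQ => //.
  by apply: env_set_mem; last lia; do 3!apply: env_set_reg => //.
by move=> r; rewrite !inE negb_or => /andP[/negPf r13 /negPf r14]; rewrite /= /upd r13 r14.
Qed.

Definition insert_or_remove (b : bool) (v : 'I_n) (D : {set 'I_n}) : {set 'I_n} :=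
  if b then v |: D else D :\ v.

Lemma card_nbhd_update b v w (D : {set 'I_n}) : (v \in D) = ~~ b ->
  #|nbhd e (insert_or_remove b v D) w| =
    if b then #|nbhd e D w| + nb w v else #|nbhd e D w| - nb w v.
Proof.
rewrite /insert_or_remove; case: b => /= vD.
  have [wv|wv] := boolP (nb w v).
    rewrite (_ : nbhd _ _ _ = v |: nbhd e D w) ?cardsU1 ?inE ?vD 1?addnC //.
    by apply/setP => x; rewrite !inE andb_orl; case: eqP => [->|] /=; rewrite ?wv.
  rewrite addn0; congr #|pred_of_set _|; apply/setP => x.
  by rewrite !inE andb_orl; case: eqP => [->|] //=; rewrite (negPf wv) !andbF.
have [wv|wv] := boolP (nb w v).
  rewrite (cardsD1 v (nbhd e D w)) inE vD wv /= addKn.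
  by congr #|pred_of_set _|; apply/setP => x; rewrite !inE andbA.
rewrite subn0; congr #|pred_of_set _|; apply/setP => x.
by rewrite !inE; case: eqP => [->|] //=; rewrite (negPf wv) !andbF.
Qed.

Lemma nbc_nat w v : (w == v) + (w \in adj v) = nb w v :> nat.
Proof.
have [_ ->] := adjP v; rewrite -topredE /= /nbc e_sym.
by case: eqP => [->|] /=; rewrite ?e_irr.
Qed.

Lemma run_update b (v : 'I_n) (D : {set 'I_n}) s (Q : nat -> state -> Prop) :
    env s -> represents s D -> reg s 15 = v -> (v \in D) = ~~ b ->
    (forall t s', t <= 7 * deg v + 11 -> env s' ->
       represents s' (insert_or_remove b v D) ->
       unchanged [:: 10; 11; 12; 13; 14] s s' -> same_lists s s' -> Q t s') ->
  run W (update b) s Q.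
Proof.
move=> es [rD rC] r15 vD hQ; have [[h1 h2 h3 h4] h5 h6 h7 h8] := es.
have hv := ltn_ord v; have hn := n_bound.
apply: run_seq; apply: (run_add (v := L + v)); first by rewrite h3 r15.
  by lia.
apply: run_seq; apply: (run_write (a := L + v) (v := b)) => //=.
    by rewrite /upd; case: b {hQ vD} => /=.
  by case: b {hQ vD}; lia.
set s1 := set_mem _ _ _.
have es1 : env s1 by apply: env_set_mem; [apply: env_set_reg | lia].
pose D' := insert_or_remove b v D.
have rD1 (w : 'I_n) : memory s1 (L + w) = (w \in D').
  rewrite /= /upd eqn_add2l rD (_ : (w == v :> nat) = (w == v)) //.
  by rewrite /D' /insert_or_remove; case: (b) vD; rewrite !inE; case: eqP => [->|].
have rC1 (w : 'I_n) : memory s1 (L + n + w) = #|nbhd e D w|.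
  by rewrite /= /upd; case: eqP => [|_]; [have := ltn_ord w; lia | exact: rC].
have cn w : #|nbhd e D w| <= n by rewrite -[X in _ <= X]card_ord max_card.
have un1 : unchanged [:: 13] s s1.
  by move=> r; rewrite inE => /negPf hr; rewrite /= /upd hr.
apply: run_seq; apply: (@run_bump b 15 s1 v _ _ es1 _ _ (rC1 v)) => //.
  by have := cn v; lia.
move=> s2 es2 un2 m2.
(* Value of the counter of [w] once [v] and its first [i] neighbours have been treated. *)
pose cnt (i : nat) (w : 'I_n) :=
  if b then #|nbhd e D w| + ((w == v) + (w \in take i (adj v)))
  else #|nbhd e D w| - ((w == v) + (w \in take i (adj v))).
pose J i t (s' : state) := [/\ t = 4 + 7 * i, unchanged [:: 10; 11; 12; 13; 14] s s',
  same_lists s s', forall w : 'I_n, memory s' (L + w) = (w \in D') &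
  forall w : 'I_n, memory s' (L + n + w) = cnt i w].
apply: (run_for_adj (J := J) (u := v)) => //.
- by rewrite un2 // un1.
- move=> s3 un3 m3; split=> //.
  + move=> r hr; rewrite un3; last by apply: contra hr; rewrite !inE => /orP[]->; rewrite ?orbT.
    rewrite un2; last by apply: contra hr; rewrite !inE => /orP[]->; rewrite ?orbT.
    by rewrite un1 //; apply: contra hr; rewrite !inE => ->; rewrite ?orbT.
  + move=> a ha; rewrite m3 m2 /upd; case: eqP => [|_]; first by lia.
    by rewrite /= /upd; case: eqP => //; lia.
  + move=> w; rewrite m3 m2 /upd; case: eqP => [|_]; first by have := ltn_ord w; lia.
    exact: rD1.
  + move=> w; rewrite m3 m2 /upd /cnt take0 in_nil addn0 eqn_add2l val_eqE rC1.
    by case: eqP => [->|_]; case: (b); rewrite ?addn1 ?subn1 ?addn0 ?subn0.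
- move=> i t s3 s4 hi [tE un3 sl3 d3 c3] es3 un4 m4 x4 es4.
  set w0 := nth v (adj v) i in x4.
  have [uniqv memv] := adjP v.
  (* As [adj v] has no repetition and does not contain [v], the counter of [w0] is still untouched
     here. *)
  have ni : w0 \notin take i (adj v).
    move: uniqv; rewrite -[X in uniq X](cat_take_drop i) (drop_nth v) // cat_uniq.
    by move=> /and3P[_ /norP[h _] _].
  have w0v : (w0 == v) = false.
    apply/eqP => eq; have : w0 \in adj v by apply: mem_nth.
    by rewrite memv eq -topredE /= e_irr.
  have tk w : (w \in take i.+1 (adj v)) = (w == w0) || (w \in take i (adj v)).
    by rewrite (take_nth v) // mem_rcons in_cons.
  apply: (@run_bump b 12 s4 w0 (cnt i w0)) => //.
      by rewrite m4 c3.
    by rewrite /cnt; have := cn w0; case: (b); have := leq_b1 (w0 == v);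
      have := leq_b1 (w0 \in take i (adj v)); have : 0 < n by [lia | case: n v hv]; lia.
  move=> s5 es5 un5 m5; split=> //; last first.
  + by rewrite un5.
  + by rewrite un5.
  split.
  + by rewrite tE; lia.
  + move=> r hr; rewrite un5; last by apply: contra hr; rewrite !inE => /orP[]->; rewrite ?orbT.
    by rewrite un4 ?un3 //; apply: contra hr; rewrite !inE => /orP[]->; rewrite ?orbT.
  + move=> a ha; rewrite m5 /upd; case: eqP => [|_]; first by have := ltn_ord w0; lia.
    by rewrite m4 sl3.
  + move=> w; rewrite m5 /upd; case: eqP => [|_]; first by have := ltn_ord w; lia.
    by rewrite m4 d3.
  + move=> w; rewrite m5 /upd eqn_add2l val_eqE m4 c3 /cnt tk.
    case: eqP => [->|_] //=; rewrite w0v (negPf ni) /=.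
    by case: (b); rewrite !add0n ?addn0 ?addn1 ?subn0 ?subn1.
move=> t s3 [tE un3 sl3 d3 c3] es3; apply: hQ => //.
  by rewrite tE; lia.
split=> // w; rewrite c3 /cnt take_size nbc_nat card_nbhd_update //.
Qed.

Definition stored (s : state) (B : nat) (l : seq 'I_n) : Prop :=
  forall i, i < size l -> memory s (B + i) = nth 0 [seq val x | x <- l] i.

Lemma stored_same s s' B l : L + 2 * n <= B -> same_lists s s' ->
  stored s B l -> stored s' B l.
Proof. by move=> hB sl st i hi; rewrite sl ?st // (leq_trans hB) ?leq_addr. Qed.

Definition insert_or_remove_all (b : bool) (l : seq 'I_n) (D : {set 'I_n}) :=
  if b then D :|: [set x in l] else D :\: [set x in l].

(** The constant 14 is the 11 of [run_update] plus the test, the read and the increment. *)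
Lemma run_update_list b B (l : seq 'I_n) M (D : {set 'I_n}) s (Q : nat -> state -> Prop) :
    env s -> represents s D -> L + 2 * n <= B -> B + size l <= W -> stored s B l -> uniq l ->
    reg s 19 = B -> reg s 24 = B + size l ->
    (forall x, x \in l -> (x \in D) = ~~ b /\ deg x <= M) ->
    (forall t s', t <= size l * (7 * M + 14) + 1 -> env s' ->
       represents s' (insert_or_remove_all b l D) ->
       unchanged [:: 10; 11; 12; 13; 14; 15; 19] s s' -> same_lists s s' -> Q t s') ->
  run W (update_list b) s Q.
Proof.
move=> es rs hB hBW st ul r19 r24 lP hQ; have hn := n_bound.
pose J i t (s' : state) := [/\ t <= i * (7 * M + 14), env s' /\ reg s' 19 = B + i,
  represents s' (insert_or_remove_all b (take i l) D),
  unchanged [:: 10; 11; 12; 13; 14; 15; 19] s s' & same_lists s s'].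
apply: run_conseq (@run_while W (size l) J _ _ _ _ _ _) _.
- split=> //; first by rewrite addn0.
  rewrite take0 /insert_or_remove_all (_ : [set x in [::]] = set0) ?setU0 ?setD0; last first.
    by apply/setP => x; rewrite !inE.
  by case: (b).
- move=> i t s1 hi [ht [es1 r1] rs1 un1 sl1].
  have r24' : reg s1 24 = B + size l by rewrite un1.
  split; first by rewrite /= r1 r24'; lia.
  have [x0 _] : exists x : 'I_n, x \in l.
    by case: l hi {st ul r24 lP hQ hBW rs1 J r24'} => // x l; exists x; rewrite mem_head.
  set v := nth x0 l i.
  have [[h1 _ _ _] _ _ _ _] := es1; have hv := ltn_ord v.
  apply: run_seq; apply: (run_read (v := v)).
      by rewrite r1 sl1 ?st ?(nth_map x0) //; lia.
    by lia.
  apply: run_seq; apply: (run_add (v := B + i.+1)); first by rewrite /= /upd /= r1 h1; lia.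
    by lia.
  set s2 := set_reg _ _ _.
  have es2 : env s2 by do 2!apply: env_set_reg => //.
  have vl : v \in l by apply: mem_nth.
  have ni : v \notin take i l.
    move: ul; rewrite -[X in uniq X](cat_take_drop i) (drop_nth x0) // cat_uniq.
    by move=> /and3P[_ /norP[h _] _].
  have [vD vM] := lP v vl.
  have setE : insert_or_remove_all b (take i.+1 l) D =
      insert_or_remove b v (insert_or_remove_all b (take i l) D).
    rewrite /insert_or_remove_all /insert_or_remove (take_nth x0) // -/v.
    case: (b); apply/setP => x; rewrite !inE mem_rcons in_cons.
      by rewrite orbCA.
    by rewrite negb_or andbA.
  apply: (@run_update b v (insert_or_remove_all b (take i l) D)) => //.
    rewrite /insert_or_remove_all -vD; case: (b); rewrite !inE (negPf ni) ?orbF //.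
  move=> t' s3 ht' es3 rs3 un3 sl3; split=> //.
  + rewrite mulSn; have : 7 * deg v <= 7 * M by rewrite leq_mul2l.
    by move: ht ht'; clear; set y := i * _; lia.
  + by split=> //; rewrite un3.
  + by rewrite setE.
  + move=> r hr; rewrite un3; last first.
      by apply: contra hr; rewrite !inE => /orP[->//|/orP[->|/orP[->|/orP[->|->]]]]; rewrite ?orbT.
    move: (hr); rewrite !inE !negb_or => /and5P[_ _ _ _ /and3P[_ /negPf a15 /negPf a19]].
    by rewrite /= /upd a15 a19 un1.
  + by move=> a ha; rewrite sl3 // sl1.
- by move=> t s1 [_ [es1 r1] _ un1 _]; rewrite /= r1 un1 // r24 ltnn.
move=> t s' [t' -> [ht [es' _] rs' un' sl']]; apply: hQ => //.
  by rewrite addn1 ltnS.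
by move: rs'; rewrite take_size.
Qed.

End Machine.

(** * The exchange at a vertex *)

Definition collect : prog :=
  for_adj 7 16 17 18 (Seq (AddReg 13 3 18) (Seq (ReadMem 14 13)
    (If (TestEq 14 1) (Seq (WriteMem 8 18) (AddReg 8 8 1)) Skip))).

Definition greedy_insert : prog :=
  Seq (AddReg 13 4 18) (Seq (ReadMem 14 13)
    (If (TestEq 14 21)
      (Seq (Move 15 18) (Seq (update true) (Seq (WriteMem 9 18) (AddReg 9 9 1))))
      Skip)).

Definition greedy : prog :=
  While (TestLt 19 8) (Seq (ReadMem 20 19) (Seq (AddReg 19 19 1)
    (for_adj 20 16 17 18 greedy_insert))).

Definition undo : prog :=
  Seq (Move 19 6) (Seq (Move 24 9) (Seq (update_list false)
    (Seq (Move 19 5) (Seq (Move 24 8) (update_list true))))).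

(** The final test compares the number of inserted vertices, [c] included, in register 14 with the
    number of removed ones in register 13. The two stored lists are what [undo] needs to restore
    [D]. *)
Definition exchange : prog :=
  Seq (Move 8 5) (Seq collect (Seq (Move 19 5) (Seq (Move 24 8)
  (Seq (update_list false) (Seq (Move 15 7) (Seq (update true)
  (Seq (WriteMem 6 7) (Seq (AddReg 9 6 1) (Seq (Move 19 5) (Seq greedy
  (Seq (SubReg 13 8 5) (Seq (SubReg 14 9 6)
  (If (TestLt 14 13) Skip undo))))))))))))).

Definition try_exchange : prog :=
  Seq (AddReg 13 3 7) (Seq (ReadMem 14 13) (If (TestEq 14 21) exchange Skip)).

(** * Combinatorics of an exchange *)

Section Exchange.
Variables (n : nat) (e : rel 'I_n).
Hypothesis e_sym : symmetric e.
Local Notation nb := (nbc e).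
Local Notation indep := (indep e).
Variables (D : {set 'I_n}) (c : 'I_n).
Hypotheses (iD : indep D) (cD : covers e D) (ncD : c \notin D).

Definition exchanged (A : seq 'I_n) : {set 'I_n} :=
  (D :\: nbhd e D c) :|: [set x in c :: A].

Definition greedy_ok (A : seq 'I_n) : Prop :=
  [/\ uniq (c :: A), indep (exchanged A), forall a, a \in A -> a \notin D
    & forall a, a \in A -> exists2 d, nb c d & nb d a].

Lemma exchangedP A x :
  x \in exchanged A = ((x \in D) && ~~ nb c x) || (x \in c :: A).
Proof.
rewrite /exchanged /nbhd in_setU in_setD [x \in [set _ in D | _]]inE [x \in [set _ in _]]inE.
by case: (x \in D); rewrite /= ?andbT ?andbF.
Qed.

Lemma greedy_ok0 : greedy_ok [::].
Proof.
split=> // x y; rewrite !exchangedP !mem_seq1.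
move=> /orP[/andP[xD cx]|/eqP->] /orP[/andP[yD cy]|/eqP->] //.
- exact: iD.
- by rewrite (nbcC e_sym) (negPf cx).
- by rewrite (negPf cy).
Qed.

Lemma exchanged_rcons A v : exchanged (rcons A v) = v |: exchanged A.
Proof.
apply/setP => x; rewrite in_setU1 !exchangedP !in_cons mem_rcons in_cons.
by case: (x == v); rewrite ?orbT.
Qed.

(** A zero counter means that [v] is independent of the current set. It also excludes [v] from [D]:
    a vertex of [D] is either still present or was removed as a neighbour of [c], and in both cases
    it is dominated. *)
Lemma greedy_ok_rcons A d v : greedy_ok A -> nb c d -> nb d v ->
  #|nbhd e (exchanged A) v| = 0 -> v \notin exchanged A /\ greedy_ok (rcons A v).
Proof.
move=> [uA iA AD A2] cd dv /eqP; rewrite cards_eq0 => /eqP nb0.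
have vno x : x \in exchanged A -> nb v x = false.
  move=> xA; apply/negP => vx.
  have : x \in nbhd e (exchanged A) v by rewrite inE xA.
  by rewrite nb0 inE.
have vA : v \notin exchanged A by apply/negP => /vno; rewrite nbcc.
split=> //; split.
- rewrite -rcons_cons rcons_uniq uA andbT; apply: contra vA.
  by rewrite exchangedP => ->; rewrite orbT.
- rewrite exchanged_rcons => x y; rewrite !in_setU1.
  move=> /orP[/eqP->|xA] /orP[/eqP->|yA] //; last exact: iA.
    by rewrite vno.
  by rewrite (nbcC e_sym) vno.
- move=> a; rewrite mem_rcons in_cons => /orP[/eqP->|/AD //].
  apply/negP => vD; have [cv|cv] := boolP (nb c v).
    by have := vno c; rewrite exchangedP mem_head orbT (nbcC e_sym) cv => /(_ isT).
  by move: vA; rewrite exchangedP vD cv.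
- move=> a; rewrite mem_rcons in_cons => /orP[/eqP->|/A2 //].
  by exists d.
Qed.

(** Only vertices dominated by a removed [d] can lose their dominator. Such a vertex is [d] itself,
    which [c] dominates, or a neighbour of [d], so scanning the neighbour lists of the removed
    vertices suffices. *)
Lemma exchanged_covers A :
    (forall d v, d \in nbhd e D c -> e d v -> exists2 x, x \in exchanged A & nb v x) ->
  covers e (exchanged A).
Proof.
move=> h v; have [d dD vd] := cD v; have [cd|cd] := boolP (nb c d); last first.
  by exists d => //; rewrite exchangedP dD cd.
move: vd; rewrite (nbcC e_sym) => /orP[/eqP <-|dv].
  by exists c; rewrite ?exchangedP ?mem_head ?orbT // (nbcC e_sym).
by apply: h dv; rewrite inE dD.
Qed.

Lemma exchanged_remove A : greedy_ok A -> exchanged A :\: [set x in c :: A] = D :\: nbhd e D c.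
Proof.
move=> [_ _ AD _]; apply/setP => x.
rewrite !in_setD exchangedP [x \in [set _ in _]]inE [x \in nbhd _ _ _]inE.
have [|_] := boolP (x \in c :: A); last first.
  by rewrite orbF /=; case: (x \in D); rewrite /= ?andbT ?andbF.
rewrite in_cons => /orP[/eqP->|/AD /negPf ->]; last by rewrite andbF.
by rewrite (negPf ncD).
Qed.

(** The greedy set itself is the witness. Its elements are independent of [c] and of the part of [D]
    that was kept, so their [D]-neighbours are among the removed vertices. *)
Lemma irreducible_exchange A : greedy_ok A -> #|nbhd e D c| <= (size A).+1 ->
  irreducible_at e D c.
Proof.
move=> [uA iA AD A2] le; right; exists [set x in A].
have mA x : x \in A -> x \in exchanged A by rewrite exchangedP in_cons => ->; rewrite !orbT.
have cA : c \in exchanged A by rewrite exchangedP mem_head orbT.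
split.
- by move=> x y; rewrite !inE => /mA xA /mA yA; apply: iA.
- move=> a; rewrite inE => aA; split=> [||d dD ad]; first exact: AD.
    apply/negP => /(iA _ _ cA (mA _ aA)) eq; move: uA.
    by rewrite /= eq aA.
  apply: contraT => cd; have dA : d \in exchanged A by rewrite exchangedP dD cd.
  by move: (AD _ aA); rewrite (iA _ _ (mA _ aA) dA ad) dD.
- by move=> a; rewrite inE; apply: A2.
- rewrite (leq_trans le) // ltnS; have /andP[_ /card_uniqP <-] := uA.
  by rewrite subset_leq_card //; apply/subsetP => x xA; rewrite inE.
Qed.

Lemma card_exchanged A : greedy_ok A ->
  #|exchanged A| + #|nbhd e D c| = #|D| + (size A).+1.
Proof.
move=> ok; have [uA iA AD A2] := ok.
have s1 : [set x in c :: A] \subset exchanged A by apply: subsetUr.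
have s2 : nbhd e D c \subset D by apply/subsetP => x; rewrite inE => /andP[].
have cE : #|[set x in c :: A]| = (size A).+1 by rewrite cardsE; apply/card_uniqP.
have := cardsDS s1; have := cardsDS s2; rewrite (exchanged_remove ok) => ->.
have := subset_leq_card s2; have := subset_leq_card s1; rewrite cE.
by move: #|exchanged A| #|nbhd e D c| #|D| (size A).+1 => a b d x; clear; lia.
Qed.

End Exchange.

(** * Runs of the collection and of the greedy insertion *)

Section ExchangeRun.
Variables (n : nat) (e : rel 'I_n) (adj : 'I_n -> seq 'I_n) (W : nat).
Local Notation L := (input_size adj).
Local Notation deg u := (size (adj u)).
Local Notation nb := (nbc e).
Local Notation indep := (indep e).
Local Notation env := (env adj).
Local Notation represents := (represents e adj).
Local Notation same_lists := (same_lists adj).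

Lemma size_uniq_ord (l : seq 'I_n) : uniq l -> size l <= n.
Proof. by move=> /card_uniqP <-; rewrite -[X in _ <= X]card_ord max_card. Qed.

Lemma represents_low s s' D : (forall a, a < L + 2 * n -> memory s' a = memory s a) ->
  represents s D -> represents s' D.
Proof. by move=> h [h1 h2]; split=> v; have := ltn_ord v => ?; rewrite h ?h1 ?h2 //; lia. Qed.

Lemma represents_set_mem s D a v : L + 2 * n <= a -> represents s D ->
  represents (set_mem s a v) D.
Proof.
by move=> ha; apply: represents_low => b hb; rewrite /= /upd; case: eqP => //; lia.
Qed.

Lemma stored_rcons s B (l : seq 'I_n) (v : 'I_n) : stored s B l ->
  stored (set_mem s (B + size l) v) B (rcons l v).
Proof.
move=> st i; rewrite size_rcons ltnS /= /upd eqn_add2l map_rcons nth_rcons size_map => hi.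
case: eqP => [->|ne]; first by rewrite ltnn.
have lt : i < size l by lia.
by rewrite lt st.
Qed.

Lemma stored_set_mem s B (l : seq 'I_n) a v : B + size l <= a -> stored s B l ->
  stored (set_mem s a v) B l.
Proof.
by move=> ha st i hi; rewrite /= /upd; case: eqP => [|_]; [lia|apply: st].
Qed.

Hypothesis e_sym : symmetric e.
Hypothesis e_irr : irreflexive e.
Hypothesis adjP : adjacency_lists e adj.
Hypothesis W_large : L + 4 * n + 2 <= W.

Lemma mem_adj u v : (v \in adj u) = e u v.
Proof. by have [_ ->] := adjP u. Qed.

Lemma run_collect (c : 'I_n) (D : {set 'I_n}) s (Q : nat -> state -> Prop) :
    env s -> represents s D -> reg s 7 = c -> reg s 8 = L + 2 * n ->
    (forall t s', t <= 8 * deg c + 5 -> env s' -> represents s' D ->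
       reg s' 8 = L + 2 * n + size [seq x <- adj c | x \in D] ->
       stored s' (L + 2 * n) [seq x <- adj c | x \in D] ->
       unchanged [:: 8; 13; 14; 16; 17; 18] s s' -> Q t s') ->
  run W collect s Q.
Proof.
move=> es rs r7 r8 hQ; have [uc _] := adjP c; have hn := n_bound adj.
have dn := size_uniq_ord uc.
pose l i := [seq x <- take i (adj c) | x \in D].
have sl i : size (l i) <= i.
  by rewrite size_filter (leq_trans (count_size _ _)) // size_take; case: ltnP.
pose J i t s' := [/\ t <= 8 * i + 4, represents s' D, reg s' 8 = L + 2 * n + size (l i),
  stored s' (L + 2 * n) (l i) & unchanged [:: 8; 13; 14; 16; 17; 18] s s'].
apply: (run_for_adj W_large (J := J) (u := c)) => //.
- move=> s' un m; split=> //.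
  + by apply: represents_low rs => a _; rewrite m.
  + by rewrite un // /l take0 addn0.
  + by rewrite /l take0.
  + by move=> r hr; rewrite un //; apply: contra hr; rewrite !inE => /orP[]->; rewrite ?orbT.
- move=> i t s1 s2 hi [ht rs1 r81 st1 un1] es1 un2 m2 x2 es2.
  set v := nth c (adj c) i in x2; have hv := ltn_ord v.
  have [[h1 _ h3 h4] _ _ _ _] := es2.
  have rs2 : represents s2 D by apply: represents_low rs1 => a _; rewrite m2.
  apply: run_seq; apply: (run_add (v := L + v)); first by rewrite h3 x2.
    by lia.
  apply: run_seq; apply: (run_read (v := v \in D)); first by rewrite /= /upd /= rs2.1.
    by have := leq_b1 (v \in D); lia.
  set s3 := set_reg _ _ _; have es3 : env s3 by do 2!apply: env_set_reg => //.
  have un3 : unchanged [:: 8; 13; 14; 16; 17; 18] s s3.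
    move=> r hr; rewrite /s3 !reg_set_neq ?un2 ?un1 //.
    + by apply: contra hr; rewrite !inE => /orP[]->; rewrite ?orbT.
    + by apply: contra hr => /eqP->.
    + by apply: contra hr => /eqP->.
  have st3 : stored s3 (L + 2 * n) (l i) by move=> j hj; rewrite /= m2 st1.
  have r83 : reg s3 8 = L + 2 * n + size (l i) by rewrite /= /upd /= un2 // r81.
  have lS : l i.+1 = if v \in D then rcons (l i) v else l i.
    by rewrite /l (take_nth c) // filter_rcons.
  apply: run_if; rewrite /= /upd /= h1.
    rewrite eqb1 => vD.
    apply: run_seq; apply: (run_write (a := L + 2 * n + size (l i)) (v := v)).
    + by rewrite r83.
    + by rewrite /= /upd /= x2.
    + by lia.
    apply: (run_add (v := L + 2 * n + size (l i.+1))).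
    + rewrite lS vD size_rcons; rewrite /= in r83; rewrite /= r83 /upd /= h1; lia.
    + by have := sl i.+1; lia.
    split.
    + split.
      * by lia.
      * by apply: (@represents_set_mem s3) => //; lia.
      * by rewrite reg_set_eq.
      * by rewrite lS vD; apply: (@stored_rcons s3).
      * move=> r hr; rewrite reg_set_neq; first by rewrite -(un3 _ hr).
        by apply: contra hr => /eqP->.
    + by rewrite reg_set_neq.
    + by rewrite reg_set_neq.
    by apply: env_set_reg => //; apply: env_set_mem => //; lia.
  rewrite eqb1 => vD; apply: run_skip; split=> //; split=> //.
  + by lia.
  + by rewrite lS (negPf vD) r83.
  + by rewrite lS (negPf vD).
move=> t s' [ht rs' r8' st' un'] es'; apply: hQ => //.
- by lia.
- by rewrite r8' /l take_size.
- by move: st'; rewrite /l take_size.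
Qed.

Section Greedy.
Variables (D : {set 'I_n}) (c : 'I_n) (M : nat) (Rl : seq 'I_n).
Hypothesis RlP : forall d, d \in Rl -> nb c d.
Hypothesis uRl : uniq Rl.
Hypothesis degM : forall x y, nb c x -> nb x y -> deg y <= M.
Local Notation cur := (exchanged e D c).
Local Notation ok := (greedy_ok e D c).

Definition greedy_state (A : seq 'I_n) (s : state) : Prop :=
  [/\ represents s (cur A), reg s 9 = L + 3 * n + (size A).+1,
      stored s (L + 3 * n) (c :: A), stored s (L + 2 * n) Rl & ok A].

Definition dominated (A : seq 'I_n) (v : 'I_n) : Prop :=
  exists2 x, x \in cur A & nb v x.

Definition greedy_regs := [:: 9; 10; 11; 12; 13; 14; 15; 16; 17; 18; 19; 20].

Lemma greedy_state_frame A s s' : greedy_state A s -> memory s' = memory s ->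
  reg s' 9 = reg s 9 -> greedy_state A s'.
Proof.
move=> [h1 h2 h3 h4 h5] m r; split=> //.
- by apply: represents_low h1 => a _; rewrite m.
- by rewrite r.
- by move=> i hi; rewrite m h3.
- by move=> i hi; rewrite m h4.
Qed.

(** The time bound is amortised: a constant 5 per scanned vertex, and [7 * M + 20] for each vertex
    by which [A] grows. *)
Lemma run_greedy_insert A d (v : 'I_n) s (Q : nat -> state -> Prop) :
    env s -> greedy_state A s -> reg s 18 = v -> nb c d -> nb d v ->
    (forall t s' A', t + size A * (7 * M + 20) <= 5 + size A' * (7 * M + 20) -> env s' ->
       greedy_state A' s' -> cur A \subset cur A' -> dominated A' v ->
       unchanged [:: 9; 10; 11; 12; 13; 14; 15] s s' -> Q t s') ->
  run W greedy_insert s Q.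
Proof.
move=> es gs r18 cd dv hQ; have [rs r9 stA stR okA] := gs.
have [[h1 _ h3 h4] _ _ h21 _] := es; have hv := ltn_ord v; have hn := n_bound adj.
have hA : (size A).+1 <= n by case: okA => u _ _ _; apply: (size_uniq_ord u).
have hR := size_uniq_ord uRl.
apply: run_seq; apply: (run_add (v := L + n + v)); first by rewrite h4 r18.
  by lia.
apply: run_seq; apply: (run_read (v := #|nbhd e (cur A) v|)).
    by rewrite /= /upd /= rs.2.
  have : #|nbhd e (cur A) v| <= n by rewrite -[X in _ <= X]card_ord max_card.
  by move: W_large; clear; lia.
set s3 := set_reg _ _ _; have es3 : env s3 by do 2!apply: env_set_reg => //.
have un3 : unchanged [:: 9; 10; 11; 12; 13; 14; 15] s s3.
  move=> r hr; rewrite /s3 !reg_set_neq //; first by apply: contra hr => /eqP->.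
  by apply: contra hr => /eqP->.
have gs3 : greedy_state A s3 by apply: greedy_state_frame gs _ _.
apply: run_if; rewrite /= /upd /= h21 => test; last first.
  apply: run_skip; apply: (hQ _ _ A) => //.
  move: test; rewrite -lt0n => /card_gt0P[x]; rewrite inE => /andP[xA vx].
  by exists x.
have [vA ok'] := greedy_ok_rcons e_sym okA cd dv (eqP test).
apply: run_seq; apply: (run_move (v := v)); first by rewrite /= /upd /= r18.
  by lia.
set s4 := set_reg _ _ _; have es4 : env s4 by apply: env_set_reg.
have gs4 : greedy_state A s4 by apply: greedy_state_frame gs3 _ _.
have [rs4 r94 stA4 stR4 _] := gs4.
apply: run_seq.
apply: (run_update e_sym e_irr adjP W_large (b := true) (v := v) (D := cur A)) => //.
  by rewrite (negPf vA).
move=> t s5 ht es5 rs5 un5 sl5.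
have r95 : reg s5 9 = L + 3 * n + (size A).+1 by rewrite un5.
have [[h15 _ _ _] _ _ _ _] := es5.
have hA' : (size A).+2 <= n.
  by case: ok' => /size_uniq_ord; rewrite /= size_rcons.
have sl4 (l : seq 'I_n) B : L + 2 * n <= B -> stored s4 B l -> stored s5 B l.
  by move=> hB st; apply: stored_same sl5 st.
apply: run_seq; apply: (run_write (a := L + 3 * n + (size A).+1) (v := v)) => //.
  + by rewrite un5 //= /upd /= r18.
  + by lia.
apply: (run_add (v := L + 3 * n + (size A).+2)).
  + by rewrite /= r95 h15; lia.
  + by lia.
apply: (hQ _ _ (rcons A v)).
- rewrite size_rcons mulSn; have : 7 * deg v <= 7 * M by rewrite leq_mul2l (degM cd dv).
  by move: ht; set y := size A * _; clear; lia.
- by apply: env_set_reg => //; apply: env_set_mem => //; lia.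
- split=> //.
  + rewrite exchanged_rcons; apply: (@represents_set_mem s5); last exact: rs5.
    by lia.
  + by rewrite reg_set_eq size_rcons.
  + by apply: (@stored_rcons s5 _ (c :: A)); apply: sl4 => //; lia.
  + by apply: (@stored_set_mem s5); [lia | apply: sl4].
- by rewrite exchanged_rcons subsetUr.
- by exists v; rewrite ?exchanged_rcons ?setU11 ?nbcc.
move=> r hr; rewrite reg_set_neq; last by apply: contra hr => /eqP->.
rewrite /= un5; last first.
  by apply: contra hr; rewrite !inE => /or4P[->|->|->|/orP[]->]; rewrite ?orbT.
rewrite reg_set_neq ?un3 //.
by apply: contra hr => /eqP->.
Qed.

Lemma run_greedy s (Q : nat -> state -> Prop) :
    env s -> greedy_state [::] s -> reg s 19 = L + 2 * n ->
    reg s 8 = L + 2 * n + size Rl ->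
    (forall t s' A, t <= size Rl * (8 * M + 10) + size A * (7 * M + 20) + 1 -> env s' ->
       greedy_state A s' -> (forall d v, d \in Rl -> e d v -> dominated A v) ->
       unchanged greedy_regs s s' -> Q t s') ->
  run W greedy s Q.
Proof.
move=> es gs r19 r8 hQ; have hR := size_uniq_ord uRl; have hn := n_bound adj.
pose J i t s' := exists A, [/\ t <= i * (8 * M + 10) + size A * (7 * M + 20),
  env s' /\ reg s' 19 = L + 2 * n + i, greedy_state A s',
  forall d v, d \in take i Rl -> e d v -> dominated A v & unchanged greedy_regs s s'].
apply: run_conseq (@run_while W (size Rl) J _ _ _ _ _ _) _.
- exists [::]; split=> //; first by rewrite addn0.
  by rewrite take0.
- move=> i t s1 hi [A [ht [es1 r191] gs1 dom1 un1]].
  have r81 : reg s1 8 = L + 2 * n + size Rl by rewrite un1.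
  split; first by rewrite /= r191 r81; lia.
  have [[h1 _ _ _] _ _ _ _] := es1.
  set d := nth c Rl i; have dR : d \in Rl by apply: mem_nth.
  have cd := RlP dR; have hd := ltn_ord d.
  apply: run_seq; apply: (run_read (v := d)).
      by case: gs1 => _ _ _ st _; rewrite r191 st // (nth_map c).
    by lia.
  apply: run_seq; apply: (run_add (v := L + 2 * n + i.+1)).
      by rewrite /= /upd /= r191 h1; lia.
    by lia.
  set s2 := set_reg _ _ _; have es2 : env s2 by do 2!apply: env_set_reg => //.
  have un2 : unchanged greedy_regs s s2.
    move=> r hr; rewrite /s2 !reg_set_neq ?un1 //; first by apply: contra hr => /eqP->.
    by apply: contra hr => /eqP->.
  have gs2 : greedy_state A s2 by apply: greedy_state_frame gs1 _ _.
  (* The constant 8 is the 3 of the loop plus the 5 of [run_greedy_insert]. Domination of the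
     scanned vertices persists because the current set only grows. *)
  pose K j t' s' := exists A', [/\ t' + size A * (7 * M + 20) <= 4 + 8 * j + size A' * (7 * M + 20),
    reg s' 19 = L + 2 * n + i.+1, greedy_state A' s' /\ cur A \subset cur A',
    forall v, v \in take j (adj d) -> dominated A' v & unchanged greedy_regs s s'].
  apply: (run_for_adj W_large (J := K) (u := d)) => //.
  + move=> s3 un3 m3; exists A; split=> //.
    * by rewrite un3.
    * by split=> //; apply: greedy_state_frame gs2 _ _ => //; rewrite un3.
    * by rewrite take0.
    * move=> r hr; rewrite un3 ?un2 //.
      by apply: contra hr; rewrite !inE => /orP[]->; rewrite ?orbT.
  + move=> j t' s3 s4 hj [A' [ht' r3 [gs3 sub3] dom3 un3]] es3 un4 m4 r18 es4.
    set v := nth d (adj d) j in r18.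
    have dv : nb d v by rewrite /nbc -mem_adj mem_nth ?orbT.
    have gs4 : greedy_state A' s4 by apply: greedy_state_frame gs3 _ _ => //; rewrite un4.
    apply: (run_greedy_insert es4 gs4 r18 cd dv).
    move=> t2 s5 A2 ht2 es5 gs5 sub5 dom5 un5; split=> //; try by rewrite un5.
    exists A2; split=> //.
    * move: ht' ht2; clear; set x := size A * _; set y := size A' * _.
      by set z := size A2 * _; lia.
    * by rewrite un5 ?un4.
    * by split=> //; apply: subset_trans sub3 sub5.
    * move=> w; rewrite (take_nth d) // mem_rcons in_cons => /orP[/eqP-> //|/dom3[x xA wx]].
      by exists x => //; apply: (subsetP sub5).
    * move=> r hr; rewrite un5; last first.
        apply: contra hr; rewrite !inE.
        by move=> /or4P[->|->|->|/or4P[->|->|->|->]]; rewrite ?orbT.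
      by rewrite un4 ?un3 //; apply: contra hr; rewrite !inE => /orP[]->; rewrite ?orbT.
  move=> t' s3 [A' [ht' r3 [gs3 sub3] dom3 un3]] es3; exists A'; split=> //.
  + have hdM : 8 * deg d <= 8 * M by rewrite leq_mul2l (degM cd (nbcc _ _)).
    rewrite mulSn; move: ht ht' hdM; clear; set x := size A * _; set y := size A' * _.
    by set z := i * _; lia.
  + move=> d' v; rewrite (take_nth c) // -/d mem_rcons in_cons => /orP[/eqP->|d'l] ev.
      by apply: dom3; rewrite take_size mem_adj.
    by have [x xA vx] := dom1 _ _ d'l ev; exists x => //; apply: (subsetP sub3).
- move=> t s1 [A [_ [es1 r191] _ _ un1]]; rewrite /= r191 un1 // r8 ltnn //.
move=> t s' [t' -> [A [ht [es' _] gs' dom' un']]]; apply: (hQ _ _ A) => //.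
  by rewrite addn1 ltnS.
by move=> d v dR; apply: dom'; rewrite take_size.
Qed.

End Greedy.
End ExchangeRun.

Lemma unchanged_trans rs1 rs2 rs s1 s2 s3 :
    unchanged rs1 s1 s2 -> unchanged rs2 s2 s3 ->
    all (mem rs) rs1 -> all (mem rs) rs2 ->
  unchanged rs s1 s3.
Proof.
move=> u1 u2 /allP h1 /allP h2 r hr; rewrite u2 ?u1 //.
  by apply: contra hr => /h1.
by apply: contra hr => /h2.
Qed.

Lemma unchanged_set_reg x s v : unchanged [:: x] s (set_reg s x v).
Proof. by move=> r; rewrite inE => hr; rewrite reg_set_neq. Qed.

Definition exchange_regs := [:: 8; 9; 10; 11; 12; 13; 14; 15; 16; 17; 18; 19; 20; 24].

(** * Runs of a whole exchange, with time proportional to a ball *)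

Section TryExchange.
Variables (n : nat) (e : rel 'I_n) (adj : 'I_n -> seq 'I_n) (W : nat).
Variable near : rel 'I_n.
Hypothesis e_sym : symmetric e.
Hypothesis e_irr : irreflexive e.
Hypothesis adjP : adjacency_lists e adj.
Local Notation L := (input_size adj).
Local Notation deg u := (size (adj u)).
Local Notation nb := (nbc e).
Local Notation indep := (indep e).
Local Notation covers := (covers e).
Local Notation env := (env adj).
Local Notation represents := (represents e adj).
Local Notation same_lists := (same_lists adj).
Hypothesis W_large : L + 4 * n + 2 <= W.
Hypothesis nb_indep5 : forall u S, indep S -> (forall v, v \in S -> nb u v) ->
  #|S| <= 5.
Hypothesis near3 : forall u v w x, nb u v -> nb v w -> nb w x -> near u x.
Hypothesis near81 : forall u S, indep S -> (forall v, v \in S -> near u v) -> #|S| <= 81.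

(** The neighbours of [y] are within three steps of [c]. Every vertex updated in an exchange is
    within two steps of [c], so this bounds the cost of each update. *)
Lemma deg_ball c x y : nb c x -> nb x y -> deg y <= #|ball near c|.
Proof.
move=> cx xy; have [uy _] := adjP y; rewrite -(card_uniqP uy).
apply/subset_leq_card/subsetP => z; rewrite (mem_adj adjP) inE => yz.
by apply: near3 cx xy _; rewrite /nbc yz orbT.
Qed.

Lemma ball_gt0 c : 0 < #|ball near c|.
Proof. by apply/card_gt0P; exists c; rewrite inE (near3 (nbcc _ _) (nbcc _ _) (nbcc _ _)). Qed.

(** [c :: A] is independent and near [c], so it has at most 81 elements; hence an exchange performs
    a bounded number of updates. *)
Lemma size_greedy D c A : greedy_ok e D c A -> size A <= 80.
Proof.
move=> [uA iA _ A2]; rewrite -ltnS -[(size A).+1]/(size (c :: A)) -(card_uniqP uA).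
rewrite -cardsE; apply: (near81 (u := c)) => [x y|x].
  by rewrite !inE => hx hy; apply: iA; rewrite exchangedP !in_cons ?hx ?hy orbT.
rewrite inE in_cons => /orP[/eqP->|/A2[d cd dx]].
  exact: near3 (nbcc _ _) (nbcc _ _) (nbcc _ _).
exact: near3 cd dx (nbcc _ _).
Qed.

Definition exchange_time := locked (50 * 100).

(** Removing the inserted vertices leaves [D] without the neighbours of [c], to which the list [Rl]
    is then added back. *)
Lemma run_undo (c : 'I_n) (D : {set 'I_n}) Rl A M s (Q : nat -> state -> Prop) :
    env s -> greedy_state e adj D c Rl A s -> reg s 8 = L + 2 * n + size Rl ->
    uniq Rl -> Rl =i nbhd e D c -> c \notin D ->
    (forall x y, nb c x -> nb x y -> deg y <= M) ->
    (forall t s', t <= (size Rl + (size A).+1) * (7 * M + 14) + 6 -> env s' ->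
       represents s' D -> unchanged exchange_regs s s' -> Q t s') ->
  run W undo s Q.
Proof.
move=> es [rs r9 stA stR okA] r8 uRl RlP ncD degM hQ.
have [_ h5 h6 _ _] := es; have [uA iA AD A2] := okA.
have hA := size_uniq_ord uA; have hR := size_uniq_ord uRl; rewrite /= in hA.
apply: run_seq; apply: (run_move (v := L + 3 * n)) => //; first by lia.
apply: run_seq; apply: (run_move (v := L + 3 * n + size (c :: A))) => //=; first by lia.
set s1 := set_reg _ _ _; have es1 : env s1 by do 2!apply: env_set_reg => //.
apply: run_seq.
apply: (run_update_list e_sym e_irr adjP W_large (b := false) (B := L + 3 * n)
  (l := c :: A) (M := M) (D := exchanged e D c A) (s := s1)) => //=; try lia.
  move=> x xA; split; first by rewrite exchangedP xA orbT.
  move: xA; rewrite in_cons => /orP[/eqP->|/A2[d cd dx]]; last exact: degM cd dx.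
  exact: degM (nbcc _ _) (nbcc _ _).
move=> t1 s2 ht1 es2 rs2 un2 sl2; rewrite /insert_or_remove_all (exchanged_remove ncD okA) in rs2.
have [_ h52 h62 _ _] := es2.
have r82 : reg s2 8 = L + 2 * n + size Rl by rewrite un2.
apply: run_seq; apply: (run_move (v := L + 2 * n)) => //; first by lia.
apply: run_seq; apply: (run_move (v := L + 2 * n + size Rl)) => //=; first by lia.
set s3 := set_reg _ _ _; have es3 : env s3 by do 2!apply: env_set_reg => //.
have stR2 : stored s2 (L + 2 * n) Rl by apply: stored_same sl2 _ => //.
apply: (run_update_list e_sym e_irr adjP W_large (b := true) (B := L + 2 * n)
  (l := Rl) (M := M) (D := D :\: nbhd e D c) (s := s3)) => //=; try lia.
  move=> x; rewrite RlP => xR; split; first by rewrite in_setD xR.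
  by move: xR; rewrite inE => /andP[_ cx]; apply: degM cx (nbcc _ _).
move=> t2 s4 ht2 es4 rs4 un4 sl4; apply: hQ => //.
- rewrite mulnDl; move: ht1 ht2; clear; set x := size Rl * _; set y := (size A).+1 * _.
  by lia.
- suff <- : insert_or_remove_all true Rl (D :\: nbhd e D c) = D by [].
  apply/setP => x; rewrite /insert_or_remove_all in_setU in_setD [x \in [set _ in Rl]]inE RlP.
  by rewrite /nbhd inE; case: (x \in D); case: (nb c x).
have u1 : unchanged exchange_regs s s1.
  exact: (unchanged_trans (rs := exchange_regs) (@unchanged_set_reg 19 s _)
    (@unchanged_set_reg 24 _ _) isT isT).
have u3 : unchanged exchange_regs s2 s3.
  exact: (unchanged_trans (rs := exchange_regs) (@unchanged_set_reg 19 s2 _)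
    (@unchanged_set_reg 24 _ _) isT isT).
have u2 := unchanged_trans (rs := exchange_regs) u1 un2 isT isT.
have u4 := unchanged_trans (rs := exchange_regs) u3 un4 isT isT.
exact: (unchanged_trans (rs := exchange_regs) u2 u4 isT isT).
Qed.

(** The continuation receives the preservation of [swept] as an implication for arbitrary [D0],
    which covers a kept and an undone exchange alike. The 4 in the time bound leaves room for the
    membership test in [try_exchange]. *)
Lemma run_exchange (c : 'I_n) (D : {set 'I_n}) s (Q : nat -> state -> Prop) :
    env s -> represents s D -> indep D -> covers D -> c \notin D -> reg s 7 = c ->
    (forall t s' D', t + 4 <= exchange_time * #|ball near c| -> env s' ->
       represents s' D' -> indep D' -> covers D' -> unchanged exchange_regs s s' ->
       (forall D0 (done done' : pred 'I_n), (forall x, done' x -> x = c \/ done x) ->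
         swept e near D0 D done -> swept e near D0 D' done') -> Q t s') ->
  run W exchange s Q.
Proof.
move=> es rs iD cD ncD r7 hQ; have [_ h5 h6 _ _] := es.
set M := #|ball near c| in hQ; have M0 : 0 < M by apply: ball_gt0.
have degM x y : nb c x -> nb x y -> deg y <= M by apply: deg_ball.
have dcM : deg c <= M by apply: degM (nbcc _ _) (nbcc _ _).
have hn := n_bound adj; have hc := ltn_ord c.
pose Rl := [seq x <- adj c | x \in D].
have uRl : uniq Rl by rewrite filter_uniq //; have [] := adjP c.
have RlE : Rl =i nbhd e D c.
  move=> x; rewrite mem_filter (mem_adj adjP) inE /nbc; case xD: (x \in D) => //=.
  by case: eqP => // eq; rewrite -eq (negPf ncD) in xD.
have RlP d : d \in Rl -> nb c d by rewrite RlE inE => /andP[].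
have sR : size Rl = #|nbhd e D c| by rewrite -(card_uniqP uRl); apply: eq_card.
have sR5 : size Rl <= 5 by rewrite sR; apply: card_nbhd.
have hR := size_uniq_ord uRl.
apply: run_seq; apply: (run_move (v := L + 2 * n)) => //; first by lia.
set s1 := set_reg _ _ _; have es1 : env s1 by apply: env_set_reg.
have un1 : unchanged [:: 8] s s1 by apply: unchanged_set_reg.
apply: run_seq; apply: (@run_collect _ e adj W adjP W_large c D) => //.
move=> t2 s2 ht2 es2 rs2 r82 st2 un2'; rewrite -/Rl in r82 st2.
have un2 := unchanged_trans (rs := exchange_regs) un1 un2' isT isT.
have [_ h52 h62 _ _] := es2.
apply: run_seq; apply: (run_move (v := L + 2 * n)) => //; first by lia.
apply: run_seq; apply: (run_move (v := L + 2 * n + size Rl)) => //=; first by lia.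
set s3 := set_reg _ _ _; have es3 : env s3 by do 2!apply: env_set_reg => //.
have un3' : unchanged exchange_regs s2 s3.
  exact: (unchanged_trans (rs := exchange_regs) (@unchanged_set_reg 19 s2 _)
    (@unchanged_set_reg 24 _ _) isT isT).
have un3 := unchanged_trans (rs := exchange_regs) un2 un3' isT isT.
apply: run_seq.
apply: (run_update_list e_sym e_irr adjP W_large (b := false) (B := L + 2 * n)
  (l := Rl) (M := M) (D := D) (s := s3)) => //; try lia.
  move=> x; rewrite RlE inE => /andP[-> cx]; split=> //.
  exact: degM cx (nbcc _ _).
move=> t4 s4 ht4 es4 rs4 un4' sl4.
have un4 := unchanged_trans (rs := exchange_regs) un3 un4' isT isT.
have r74 : reg s4 7 = c by rewrite un4.
apply: run_seq; apply: (run_move (v := c)) => //; first by lia.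
set s5 := set_reg _ _ _; have es5 : env s5 by apply: env_set_reg.
have un5 := unchanged_trans (rs := exchange_regs) un4 (@unchanged_set_reg 15 _ c) isT isT.
have setE : insert_or_remove_all false Rl D = D :\: nbhd e D c.
  by apply/setP => x; rewrite /insert_or_remove_all !in_setD [x \in [set _ in Rl]]inE RlE.
rewrite setE in rs4.
apply: run_seq.
apply: (run_update e_sym e_irr adjP W_large (b := true) (v := c)
  (D := D :\: nbhd e D c) (s := s5)) => //.
  by rewrite in_setD (negPf ncD) andbF.
move=> t6 s6 ht6 es6 rs6 un6' sl6.
have un6 := unchanged_trans (rs := exchange_regs) un5 un6' isT isT.
have [[h16 _ _ _] h56 h66 _ _] := es6.
have r76 : reg s6 7 = c by rewrite un6.
apply: run_seq; apply: (run_write (a := L + 3 * n) (v := c)) => //; first by lia.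
apply: run_seq; apply: (run_add (v := L + 3 * n + 1)); first by rewrite /= h66 h16.
  by lia.
apply: run_seq; apply: (run_move (v := L + 2 * n)) => //; first by lia.
set s7 := set_reg _ _ _.
have es7 : env s7.
  by do 2!apply: env_set_reg => //; apply: env_set_mem => //; lia.
have un7 : unchanged exchange_regs s s7.
  move=> r hr; rewrite /s7 !reg_set_neq ?[reg (set_mem _ _ _) _]un6 //.
    by apply: contra hr => /eqP->.
  by apply: contra hr => /eqP->.
have r87 : reg s7 8 = L + 2 * n + size Rl.
  by rewrite /= /upd /= un6' // -r82 [reg s5 8]un4'.
have stR7 : stored s7 (L + 2 * n) Rl.
  apply: (@stored_set_mem _ s6); first by lia.
  apply: stored_same sl6 _ => //.
  by apply: (@stored_same _ _ s3) => //.
have rs7 : represents s7 (exchanged e D c [::]).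
  apply: (@represents_set_mem _ _ _ s6); first by lia.
  suff <- : insert_or_remove true c (D :\: nbhd e D c) = exchanged e D c [::] by [].
  rewrite /insert_or_remove /exchanged setUC; congr (_ :|: _).
  by apply/setP => x; rewrite !inE.
have gs7 : greedy_state e adj D c Rl [::] s7.
  split=> //; last exact: greedy_ok0.
  move=> [|i] //= _; by rewrite /upd addn0 eqxx.
apply: run_seq.
apply: (@run_greedy _ e adj W e_sym e_irr adjP W_large D c M Rl RlP uRl degM s7) => //.
move=> t8 s8 A ht8 es8 gs8 dom8 un8'.
have un8 := unchanged_trans (rs := exchange_regs) un7 un8' isT isT.
have r88 : reg s8 8 = L + 2 * n + size Rl by rewrite un8'.
have [rs8 r98 stA8 stR8 ok8] := gs8.
have [_ iA8 _ _] := ok8.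
have sA80 := size_greedy ok8.
have sAn : (size A).+1 <= n by case: ok8 => u _ _ _; apply: (size_uniq_ord u).
have [_ h58 h68 _ _] := es8.
have cA : covers (exchanged e D c A).
  by apply: exchanged_covers => // d v; rewrite -RlE => dR; apply: dom8.
apply: run_seq; apply: (run_sub (v := size Rl)); first by rewrite r88 h58 addKn.
  by lia.
apply: run_seq; apply: (run_sub (v := (size A).+1)); first by rewrite /= /upd /= r98 h68 addKn.
  by lia.
set s9 := set_reg _ _ _.
have un9' : unchanged exchange_regs s8 s9.
  exact: (unchanged_trans (rs := exchange_regs) (@unchanged_set_reg 13 s8 _)
    (@unchanged_set_reg 14 _ _) isT isT).
have un9 := unchanged_trans (rs := exchange_regs) un8 un9' isT isT.
have es9 : env s9 by do 2!apply: env_set_reg => //.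
have gs9 : greedy_state e adj D c Rl A s9 by apply: greedy_state_frame gs8 _ _.
have mul5 k : size Rl * k <= 5 * k by rewrite leq_mul2r sR5 orbT.
have mul80 k : size A * k <= 80 * k by rewrite leq_mul2r sA80 orbT.
apply: run_if => /=; rewrite /upd /= => cmp.
  apply: run_skip; apply: (hQ _ _ (exchanged e D c A)) => //.
    have := mul5 (7 * M + 14); have := mul5 (8 * M + 10); have := mul80 (7 * M + 20).
    rewrite /exchange_time -lock; move: ht2 ht4 ht6 ht8 M0 dcM.
    set x1 := size Rl * _; set x2 := size Rl * _; set x3 := size A * _.
    by move: (deg c) => dc; clear; lia.
  move=> D0 dn dn' hd sw.
  have cE := card_exchanged ncD ok8.
  (* At most 5 vertices were removed, and fewer were inserted, so at most 10 changed. *)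
  apply: (@swept_improve _ e near _ D0 D (exchanged e D c A) dn dn' c
    (nbhd e D c :|: [set x in c :: A])) => //.
  - by move: cE cmp; rewrite sR; move: #|exchanged _ _ _ _| #|nbhd _ _ _| #|D|;
      move: (size A) => x a b d; clear; lia.
  - apply: leq_trans (leq_card_setU _ _).1 _.
    have -> : #|[set x in c :: A]| = (size A).+1.
      by rewrite cardsE; apply/card_uniqP; case: ok8.
    by move: cmp sR5; rewrite sR; move: #|nbhd _ _ _| (size A) => x y; clear; lia.
  - by rewrite !inE eqxx orbT.
  - move=> x; rewrite in_setU negb_or exchangedP [x \in [set _ in _]]inE => /andP[+ /negPf ->].
    by rewrite inE orbF; case: (x \in D) => //=; case: nb.
apply: (@run_undo c D Rl A M s9) => //.
move=> t10 s10 ht10 es10 rs10 un10'.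
have un10 := unchanged_trans (rs := exchange_regs) un9 un10' isT isT.
apply: (hQ _ _ D) => //.
  move: ht10; rewrite mulnDl mulSn.
  have := mul5 (7 * M + 14); have := mul5 (8 * M + 10); have := mul80 (7 * M + 20).
  have := mul80 (7 * M + 14).
  rewrite /exchange_time -lock; move: ht2 ht4 ht6 ht8 M0 dcM.
  set x1 := size Rl * (7 * M + 14); set x2 := size Rl * _.
  set x3 := size A * _; set x4 := size A * _.
  by move: (deg c) => dc; clear; lia.
move=> D0 dn dn' hd sw; apply: swept_keep hd sw _.
apply: (irreducible_exchange ok8).
by move: cmp; rewrite sR -leqNgt.
Qed.

Lemma run_try_exchange (c : 'I_n) (D : {set 'I_n}) s (Q : nat -> state -> Prop) :
    env s -> represents s D -> indep D -> covers D -> reg s 7 = c ->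
    (forall t s' D', t <= exchange_time * #|ball near c| -> env s' ->
       represents s' D' -> indep D' -> covers D' -> unchanged exchange_regs s s' ->
       (forall D0 (done done' : pred 'I_n), (forall x, done' x -> x = c \/ done x) ->
         swept e near D0 D done -> swept e near D0 D' done') -> Q t s') ->
  run W try_exchange s Q.
Proof.
move=> es rs iD cD r7 hQ; have [[_ _ h3 _] _ _ h21 _] := es; have hc := ltn_ord c.
apply: run_seq; apply: (run_add (v := L + c)); first by rewrite h3 r7.
  by lia.
apply: run_seq; apply: (run_read (v := c \in D)); first by rewrite /= /upd /= rs.1.
  by have := leq_b1 (c \in D); lia.
set s1 := set_reg _ _ _; have es1 : env s1 by do 2!apply: env_set_reg => //.
have un1 : unchanged exchange_regs s s1.
  exact: (unchanged_trans (rs := exchange_regs) (@unchanged_set_reg 13 s _)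
    (@unchanged_set_reg 14 _ _) isT isT).
apply: run_if; rewrite /= /upd /= h21.
  rewrite eqb0 => ncD; apply: (@run_exchange c D s1) => //.
  move=> t s' D' ht es' rs' iD' cD' un' sw; apply: (hQ _ _ D') => //; first by lia.
  exact: (unchanged_trans (rs := exchange_regs) un1 un' isT isT).
rewrite eqb0 negbK => cD'; apply: run_skip; apply: (hQ _ _ D) => //.
  have := ball_gt0 c; rewrite /exchange_time -lock; move: #|ball near c| => x.
  by clear; lia.
by move=> D0 dn dn' hd sw; apply: swept_keep hd sw _; left.
Qed.

End TryExchange.

(** * The program *)

Definition setup : prog :=
  Seq (Const 1 1) (Seq (ReadMem 2 21) (Seq (ReadMem 3 2) (Seq (ReadMem 4 3)
  (Seq (AddReg 3 3 4) (Seq (AddReg 3 3 1) (Seq (AddReg 4 3 2)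
  (Seq (AddReg 5 4 2) (AddReg 6 5 2)))))))).

Definition for_vertices (body : prog) : prog :=
  Seq (Const 7 0) (While (TestLt 7 2) (Seq body (AddReg 7 7 1))).

Definition insert_if_free : prog :=
  Seq (AddReg 13 4 7) (Seq (ReadMem 14 13)
    (If (TestEq 14 21) (Seq (Move 15 7) (update true)) Skip)).

Definition sweeps (T : nat) : prog :=
  Seq (Const 23 T) (While (TestLt 22 23)
    (Seq (for_vertices try_exchange) (AddReg 22 22 1))).

Definition output_vertex : prog :=
  Seq (AddReg 13 3 7) (Seq (ReadMem 14 13)
    (If (TestEq 14 1) (Seq (AddReg 8 8 1) (WriteMem 8 7)) Skip)).

Definition output : prog :=
  Seq (Move 8 5) (Seq (for_vertices output_vertex)
    (Seq (SubReg 13 8 5) (Seq (WriteMem 5 13) (Move 0 5)))).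

Definition dominating_set_prog (T : nat) : prog :=
  Seq setup (Seq (for_vertices insert_if_free) (Seq (sweeps T) output)).

Lemma sum_lt_succ n (F : 'I_n -> nat) (u : 'I_n) :
  \sum_(v < n | v < u.+1) F v = F u + \sum_(v < n | v < u) F v.
Proof.
rewrite (bigD1 u) //=; congr (_ + _); apply: eq_bigl => v.
by rewrite ltnS ltn_neqAle andbC.
Qed.

Lemma sum_lt_all n (F : 'I_n -> nat) : \sum_(v < n | v < n) F v = \sum_v F v.
Proof. by apply: eq_bigl => v; rewrite ltn_ord. Qed.

Lemma handshake n (e : rel 'I_n) adj : simple_graph e -> adjacency_lists e adj ->
  \sum_u size (adj u) <= 2 * num_edges e.
Proof.
move=> [e_sym e_irr] adjP.
pose E := [set uv : 'I_n * 'I_n | (uv.1 < uv.2) && e uv.1 uv.2].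
pose P := [set uv : 'I_n * 'I_n | e uv.1 uv.2].
have -> : \sum_u size (adj u) = #|P|.
  transitivity (\sum_u \sum_v (e u v : nat)).
    apply: eq_bigr => u _; have [uu mu] := adjP u; rewrite -(card_uniqP uu) -sum1_card.
    by rewrite big_mkcond; apply: eq_bigr => v _; rewrite mu -topredE /=; case: (e u v).
  rewrite pair_bigA -[RHS]sum1_card [RHS]big_mkcond; apply: eq_bigr => p _.
  by rewrite inE; case: (e _ _).
have sub : P \subset E :|: [set (uv.2, uv.1) | uv in E].
  apply/subsetP => -[u v]; rewrite !inE /= => euv; rewrite euv andbT.
  case: (ltngtP u v) => [//|vu|/val_inj uv]; last by rewrite uv e_irr in euv.
  by apply/imsetP; exists (v, u); rewrite // inE /= vu e_sym.
rewrite (leq_trans (subset_leq_card sub)) // (leq_trans (leq_card_setU _ _).1) //.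
by rewrite mul2n -addnn leq_add2l leq_imset_card.
Qed.

(** This is how the program finds the first free address: cell [n] holds the address of the last
    neighbour list, and the cell at that address holds its length. *)
Lemma input_base n (adj : 'I_n -> seq 'I_n) :
  let I := nth 0 (input_words adj) in I n + I (I n) + 1 = input_size adj.
Proof.
(* For [n = 0] the only word is 0, and the formula still gives 0 + 0 + 1. *)
move=> I; have [n0|n0] := posnP n.
  by move: adj @I; rewrite n0 => adj I; rewrite input_sizeE big_ord0.
have hl : n.-1 < n by rewrite prednK.
pose u := Ordinal hl; have un : u.+1 = n by rewrite /= prednK.
have In : I n = adj_address adj u by rewrite -{1}un /I input_address.
rewrite In /I -{2}[adj_address adj u]addn0 input_block //= size_map.
by rewrite -(adj_address_last adj un) -addnA addn1.
Qed.

(** * Runs of the phases of the program *)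

Section Program.
Variables (n : nat) (e : rel 'I_n) (adj : 'I_n -> seq 'I_n) (W : nat).
Variable near : rel 'I_n.
Local Notation L := (input_size adj).
Local Notation deg u := (size (adj u)).
Local Notation nb := (nbc e).
Local Notation indep := (indep e).
Local Notation covers := (covers e).
Local Notation env := (env adj).
Local Notation represents := (represents e adj).
Hypothesis W_large : L + 4 * n + 2 <= W.

(** No array has to be initialised: the zeros behind the input already represent the empty set with
    all counters 0. *)
Lemma run_setup (Q : nat -> state -> Prop) :
    (forall s', env s' -> represents s' set0 -> reg s' 22 = 0 -> Q 9 s') ->
  run W setup (initial_state adj) Q.
Proof.
move=> hQ; have base := input_base adj; rewrite /= in base.
have hn := n_bound adj.
apply: run_seq; apply: run_const; first by lia.
apply: run_seq; apply: (run_read (v := n)) => //; first by lia.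
set I := nth 0 (input_words adj) in base.
apply: run_seq; apply: (run_read (v := I n)) => //; first by lia.
apply: run_seq; apply: (run_read (v := I (I n))) => //; first by lia.
apply: run_seq; apply: (run_add (v := I n + I (I n))) => //; first by lia.
apply: run_seq; apply: (run_add (v := L)); first by rewrite -base.
  by lia.
apply: run_seq; apply: (run_add (v := L + n)) => //; first by lia.
apply: run_seq; apply: (run_add (v := L + 2 * n)).
    by rewrite /= /upd /=; lia.
  by lia.
apply: (run_add (v := L + 3 * n)).
    by rewrite /= /upd /=; lia.
  by lia.
apply: hQ => //.
have z a : L <= a -> nth 0 (input_words adj) a = 0 by move=> h; rewrite nth_default.
have nb0 v : #|nbhd e set0 v| = 0.
  by apply/eqP; rewrite cards_eq0; apply/eqP/setP => x; rewrite !inE.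
split=> v.
  by apply: etrans (z (L + v) _) _; rewrite ?leq_addr ?inE.
by apply: etrans (z (L + n + v) _) _; rewrite ?nb0 // -addnA leq_addr.
Qed.

(** The invariant is asked for in every state that differs from the end of the body in register 7 at
    most, which absorbs the increment of the loop variable. *)
Lemma run_for_vertices (J : nat -> nat -> state -> Prop) body s (Q : nat -> state -> Prop) :
    env s ->
    (forall s', unchanged [:: 7] s s' -> memory s' = memory s -> J 0 1 s') ->
    (forall (u : 'I_n) t s1, J u t s1 -> env s1 -> reg s1 7 = u ->
       run W body s1 (fun t' s2 => [/\ env s2, reg s2 7 = u &
         forall s3, unchanged [:: 7] s2 s3 -> memory s3 = memory s2 ->
           J u.+1 (t + t' + 2) s3])) ->
    (forall t s', J n t s' -> env s' -> Q t.+1 s') ->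
  run W (for_vertices body) s Q.
Proof.
move=> es J0 Jstep Jend; have hn := n_bound adj.
apply: run_seq; apply: run_const; first by lia.
have es1 := env_set_reg 0 es (isT : 7 \notin const_regs).
pose K i t s' := [/\ J i (1 + t) s', env s' & reg s' 7 = i].
apply: run_conseq (@run_while W n K _ _ _ _ _ _) _.
- by split=> //; rewrite addn0; apply: J0 => //; apply: unchanged_set_reg.
- move=> i t s1 hi [J1 es2 r7]; have [[h1 h2 _ _] _ _ _ _] := es2.
  split; first by rewrite /= r7 h2.
  apply: run_seq; apply: run_conseq (Jstep (Ordinal hi) _ s1 J1 es2 r7) _.
  move=> t' s2 [es3 r73 J3]; have [[h13 _ _ _] _ _ _ _] := es3.
  apply: (run_add (v := i.+1)); first by rewrite r73 h13 addn1.
    by lia.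
  split=> //.
  have -> : 1 + (t + (t' + 1)).+1 = 1 + t + t' + 2 by lia.
  by apply: J3 => //; apply: unchanged_set_reg.
- by move=> t s1 [_ es2 r7]; have [[_ h2 _ _] _ _ _ _] := es2; rewrite /= r7 h2 ltnn.
by move=> t s' [t' -> [J' es' _]]; rewrite addnS; apply: Jend.
Qed.

Lemma represents_memory s s' D : memory s' = memory s -> represents s D -> represents s' D.
Proof. by move=> m; apply: represents_low => a _; rewrite m. Qed.

Lemma run_output s (D : {set 'I_n}) (Q : nat -> state -> Prop) :
    env s -> represents s D ->
    (forall t s', t <= 8 * n + 6 -> outputs s' D -> Q t s') ->
  run W output s Q.
Proof.
move=> es rs hQ; have [_ h5 _ _ _] := es; have hn := n_bound adj.
apply: run_seq; apply: (run_move (v := L + 2 * n)) => //; first by lia.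
set s0 := set_reg _ _ _; have es0 : env s0 by apply: env_set_reg.
pose l i := [seq v <- take i (enum 'I_n) | v \in D].
have sl i : size (l i) <= i.
  by rewrite size_filter (leq_trans (count_size _ _)) // size_take; case: ltnP.
(* The output reuses the area of the exchange lists. Its first cell is kept free for the length, so
   register 8 points to the last entry written. *)
pose J i t s' := [/\ t <= 8 * i + 1, represents s' D, reg s' 8 = L + 2 * n + size (l i) &
  stored s' (L + 2 * n + 1) (l i)].
apply: run_seq; apply: (run_for_vertices (J := J)) => //.
- move=> s' un m; split=> //.
  + exact: (@represents_memory s).
  + by rewrite un //= /upd /= /l take0 addn0.
  + by rewrite /l take0.
- move=> u t s1 [ht rs1 r8 st1] es1 r7; have hu := ltn_ord u; have slu := sl u.
  have [[h1 _ h3 _] _ _ _ _] := es1.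
  have lS : l u.+1 = if u \in D then rcons (l u) u else l u.
    by rewrite /l (take_nth u) ?size_enum_ord // filter_rcons nth_ord_enum.
  apply: run_seq; apply: (run_add (v := L + u)); first by rewrite h3 r7.
    by lia.
  apply: run_seq; apply: (run_read (v := u \in D)); first by rewrite /= /upd /= rs1.1.
    by have := leq_b1 (u \in D); lia.
  set s2 := set_reg _ _ _; have es2 : env s2 by do 2!apply: env_set_reg => //.
  apply: run_if; rewrite /= /upd /= h1 eqb1 => uD; last first.
    apply: run_skip; split=> // s3 un3 m3; rewrite /J lS (negPf uD); split.
    + by lia.
    + exact: (@represents_memory s1).
    + by rewrite un3.
    + by move=> i hi; rewrite m3 st1.
  apply: run_seq; apply: (run_add (v := L + 2 * n + 1 + size (l u))).
      by rewrite /= /upd /= r8 h1 addnAC.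
    by lia.
  apply: (run_write (a := L + 2 * n + 1 + size (l u)) (v := u)) => //; first by lia.
  split=> //; first by apply: env_set_mem; [apply: env_set_reg | lia].
  move=> s3 un3 m3; rewrite /J lS uD; split.
  + by lia.
  + by apply: represents_memory m3 _; apply: (@represents_set_mem _ _ _ s1) => //; lia.
  + by rewrite un3 //= /upd /= size_rcons; lia.
  + move=> i hi; rewrite m3.
    exact: (@stored_rcons _ s1).
move=> t s' [ht rs' r8 st'] es'; have [_ h5' _ _ _] := es'.
have sln := sl n.
apply: run_seq; apply: (run_sub (v := size (l n))); first by rewrite r8 h5' addKn.
  by lia.
apply: run_seq; apply: (run_write (a := L + 2 * n) (v := size (l n))) => //; first by lia.
apply: (run_move (v := L + 2 * n)) => //; first by lia.
apply: hQ; first by lia.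
exists [seq val v | v <- l n]; split.
  case=> [|i] /=; rewrite /upd /= ?size_map.
    by rewrite addn0 eqxx.
  rewrite ltnS => hi; case: eqP => [|_]; first by lia.
  by rewrite -[i.+1]add1n addnA st'.
apply: perm_map; apply: uniq_perm; rewrite ?enum_uniq ?filter_uniq ?take_uniq ?enum_uniq //.
move=> x; rewrite mem_enum mem_filter take_oversize ?size_enum_ord // mem_enum.
by rewrite andbT.
Qed.

Hypothesis e_sym : symmetric e.
Hypothesis e_irr : irreflexive e.
Hypothesis adjP : adjacency_lists e adj.

(** Inserting each vertex whose counter is 0 yields a maximal independent set: a treated vertex is
    dominated from then on, and an inserted one is independent of the earlier ones. *)
Lemma run_initial s (Q : nat -> state -> Prop) :
    env s -> represents s set0 ->
    (forall t s' D, t <= \sum_u (7 * deg u + 20) + 2 -> env s' -> represents s' D ->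
       indep D -> covers D -> reg s' 22 = reg s 22 -> Q t s') ->
  run W (for_vertices insert_if_free) s Q.
Proof.
move=> es rs hQ.
pose J i t s' := exists D, [/\ t <= \sum_(u < n | u < i) (7 * deg u + 20) + 1,
  represents s' D, indep D, (forall v : 'I_n, v < i -> exists2 d, d \in D & nb v d) &
  reg s' 22 = reg s 22].
apply: (run_for_vertices (J := J)) => //.
- move=> s' un m; exists set0; split=> //.
  + by rewrite leq_addl.
  + exact: represents_memory m rs.
  + by move=> x y; rewrite inE.
  + by rewrite un.
- move=> u t s1 [D [ht rs1 iD dom1 r22]] es1 r7; have hu := ltn_ord u.
  have [[h1 _ _ h4] _ _ h21 _] := es1.
  apply: run_seq; apply: (run_add (v := L + n + u)); first by rewrite h4 r7.
    by lia.
  apply: run_seq; apply: (run_read (v := #|nbhd e D u|)); first by rewrite /= /upd /= rs1.2.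
    have : #|nbhd e D u| <= n by rewrite -[X in _ <= X]card_ord max_card.
    by move: W_large; clear; lia.
  set s2 := set_reg _ _ _; have es2 : env s2 by do 2!apply: env_set_reg => //.
  apply: run_if; rewrite /= /upd /= h21 => test; last first.
    apply: run_skip; split=> // s3 un3 m3; exists D; split=> //.
    + by rewrite sum_lt_succ; move: ht; set y := \sum_(_ < _ | _) _; lia.
    + exact: (@represents_memory s1).
    + move=> v; rewrite ltnS leq_eqVlt => /orP[/eqP/val_inj ->|/dom1 //].
      by move: test; rewrite -lt0n => /card_gt0P[x]; rewrite inE => /andP[]; exists x.
    + by rewrite un3.
  have uno x : x \in D -> nb u x = false.
    move=> xD; apply/negP => ux; move: test; rewrite cards_eq0 => /eqP/setP/(_ x).
    by rewrite !inE xD ux.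
  have uD : u \notin D by apply/negP => /uno; rewrite nbcc.
  apply: run_seq; apply: (run_move (v := u)) => //; first by lia.
  set s3 := set_reg _ _ _; have es3 : env s3 by apply: env_set_reg.
  apply: (run_update e_sym e_irr adjP W_large (b := true) (v := u) (D := D) (s := s3)) => //.
    by rewrite (negPf uD).
  move=> t4 s4 ht4 es4 rs4 un4 sl4; split=> //; first by rewrite un4.
  move=> s5 un5 m5; exists (u |: D); split.
  + by rewrite sum_lt_succ; move: ht ht4; set y := \sum_(_ < _ | _) _; lia.
  + exact: represents_memory m5 rs4.
  + move=> x y; rewrite !in_setU1 => /orP[/eqP->|xD] /orP[/eqP->|yD] //; last exact: iD.
      by rewrite uno.
    by rewrite (nbcC e_sym) uno.
  + move=> v; rewrite ltnS leq_eqVlt => /orP[/eqP/val_inj ->|/dom1[d dD vd]].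
      by exists u; rewrite ?setU11 ?nbcc.
    by exists d; rewrite // in_setU1 dD orbT.
  + by rewrite un5 // un4.
move=> t s' [D [ht rs' iD dom' r22]] es'; apply: (hQ _ _ D) => //.
  move: ht; rewrite sum_lt_all.
  by set y := \sum_(_ < _) _; lia.
by move=> v; apply: dom'.
Qed.

Hypothesis nb_indep5 : forall u S, indep S -> (forall v, v \in S -> nb u v) ->
  #|S| <= 5.
Hypothesis near3 : forall u v w x, nb u v -> nb v w -> nb w x -> near u x.
Hypothesis near81 : forall u S, indep S -> (forall v, v \in S -> near u v) -> #|S| <= 81.

Definition sweep_time := \sum_u (exchange_time * #|ball near u| + 2) + 3.

Lemma run_sweep s (D : {set 'I_n}) (Q : nat -> state -> Prop) :
    env s -> represents s D -> indep D -> covers D ->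
    (forall t s' D', t < sweep_time -> env s' -> represents s' D' -> indep D' -> covers D' ->
       swept e near D D' predT -> reg s' 22 = reg s 22 -> reg s' 23 = reg s 23 -> Q t s') ->
  run W (for_vertices try_exchange) s Q.
Proof.
move=> es rs iD cD hQ.
pose J i t s' := exists D', [/\
  t <= \sum_(u < n | u < i) (exchange_time * #|ball near u| + 2) + 1,
  represents s' D', indep D' /\ covers D', swept e near D D' (fun v => v < i) &
  reg s' 22 = reg s 22 /\ reg s' 23 = reg s 23].
apply: (run_for_vertices (J := J)) => //.
- move=> s' un m; exists D; split=> //.
  + by rewrite leq_addl.
  + exact: represents_memory m rs.
  + exact: swept0.
  + by rewrite !un.
- move=> u t s1 [D1 [ht rs1 [iD1 cD1] sw1 [r22 r23]]] es1 r7.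
  apply: (run_try_exchange e_sym e_irr adjP W_large nb_indep5 near3 near81 es1 rs1 iD1 cD1 r7).
  move=> t2 s2 D2 ht2 es2 rs2 iD2 cD2 un2 sw2; split=> //; first by rewrite un2.
  move=> s3 un3 m3; exists D2; split=> //.
  + rewrite sum_lt_succ; move: ht ht2; set y := \sum_(_ < _ | _) _; set z := _ * _.
    by clear; lia.
  + exact: represents_memory m3 rs2.
  + apply: sw2 sw1 => v; rewrite ltnS leq_eqVlt => /orP[/eqP/val_inj|]; first by left.
    by right.
  + by rewrite !un3 // !un2.
move=> t s' [D' [ht rs' [iD' cD'] sw' [r22 r23]]] es'; apply: (hQ _ _ D') => //.
  move: ht; rewrite sum_lt_all.
  by rewrite /sweep_time; set y := \sum_(_ < _) _; lia.
by case: sw' => X [h1 h2]; exists X; split=> // c _; apply: h2.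
Qed.

Variable T : nat.
Hypothesis T_word : T <= W.

Lemma run_sweeps s (D : {set 'I_n}) (Q : nat -> state -> Prop) :
    (forall t D0 D', indep D' -> covers D' -> progress e t D0 ->
       swept e near D0 D' predT -> progress e t.+1 D') ->
    env s -> represents s D -> indep D -> covers D -> progress e 0 D -> reg s 22 = 0 ->
    (forall t s' D', t <= T * (sweep_time + 1) + 2 -> env s' -> represents s' D' ->
       indep D' -> covers D' -> progress e T D' -> Q t s') ->
  run W (sweeps T) s Q.
Proof.
move=> prS es rs iD cD pr r22 hQ.
apply: run_seq; apply: run_const => //.
have es1 := env_set_reg T es (isT : 23 \notin const_regs).
pose J i t s' := exists D', [/\ t <= i * (sweep_time + 1), env s' /\ represents s' D',
  indep D' /\ covers D', progress e i D' & reg s' 22 = i /\ reg s' 23 = T].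
apply: run_conseq (@run_while W T J _ _ _ _ _ _) _.
- by exists D.
- move=> i t s1 hi [D1 [ht [es2 rs2] [iD1 cD1] pr1 [r22' r23']]].
  split; first by rewrite /= r22' r23'.
  apply: run_seq; apply: (run_sweep es2 rs2 iD1 cD1).
  move=> t3 s3 D3 ht3 es3 rs3 iD3 cD3 sw3 r223 r233.
  have [[h1 _ _ _] _ _ _ _] := es3.
  apply: (run_add (v := i.+1)); first by rewrite r223 r22' h1 addn1.
    by lia.
  exists D3; split=> //.
  + by rewrite mulSn; move: ht ht3; set y := i * _; clear; lia.
  + exact: prS pr1 sw3.
  + by rewrite /= /upd /= r233 r23'.
- by move=> t s1 [D1 [_ _ _ _ [r22' r23']]]; rewrite /= r22' r23' ltnn.
move=> t s' [t' -> [D' [ht [es' rs'] [iD' cD'] pr' _]]]; apply: (hQ _ _ D') => //.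
by move: ht; set y := T * _; clear; lia.
Qed.

End Program.

(** * The constants and the final bound *)

Definition sweep_count := 5 * change_cost.

Definition time_factor :=
  sweep_count * (exchange_time * (2 * (81 * 2)) + 10) + 100.

Lemma dominating_set_prog_correct (R : realType) (n : nat) (e : rel 'I_n)
    (adj : 'I_n -> seq 'I_n) :
    simple_graph e -> unit_disk_graph R e -> adjacency_lists e adj ->
    let bound := time_factor * (n + num_edges e).+1 in
  exists (t : nat) (s : state) (D : {set 'I_n}),
    [/\ exec bound (dominating_set_prog sweep_count) (initial_state adj) t s,
        t <= bound, outputs s D, dominating e D
      & forall S, dominating e S -> 9 * #|D| <= 44 * #|S|].
Proof.
move=> sg [pos posP] adjP bound; have [e_sym e_irr] := sg.
(* The embedding enters only the analysis: radius 3 accommodates three steps, and the box has 9 * 9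
   = 81 cells. *)
pose near := in_box pos 3; pose cellof := cell pos 3.
have I5 := indep_disc posP.
have I35 := indep_two_steps posP.
have near_sym : symmetric near := in_box_sym pos 3.
have near3 u v w x : nbc e u v -> nbc e v w -> nbc e w x -> near u x.
  move=> uv vw wx.
  exact: (in_boxD (in_boxD (in_box_nbc posP uv) (in_box_nbc posP vw)) (in_box_nbc posP wx)).
have near_cell u v w : near u v -> near u w -> cellof u v = cellof u w -> nbc e v w.
  exact: (cell_eq posP (k := 3) isT).
have card_cell : #|{: 'I_((3 * 3).-1.+1) * 'I_((3 * 3).-1.+1)}| <= 81.
  by rewrite card_prod !card_ord.
have near81 := indep_near near_cell card_cell.
have deg2 := handshake sg adjP.
pose N := (n + num_edges e).+1; rewrite -/N in bound *.
have sumD (F : 'I_n -> nat) k : \sum_u (F u + k) = \sum_u F u + n * k.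
  by rewrite big_split /= sum_nat_const card_ord.
have LE : input_size adj <= 3 * N.
  rewrite input_sizeE; under eq_bigr do rewrite -addn1.
  by rewrite sumD; move: deg2; rewrite /N; set y := \sum_u _; lia.
have W_large : input_size adj + 4 * n + 2 <= bound.
  apply: (@leq_trans (100 * N)); first by move: LE; rewrite /N; lia.
  by rewrite leq_mul2r leq_addl orbT.
have T_word : sweep_count <= bound.
  rewrite /bound /time_factor mulnDl -[X in X <= _]muln1 -[X in _ <= X + _]mulnA.
  rewrite (leq_trans _ (leq_addr _ _)) // leq_mul2l; apply/orP; right.
  by rewrite muln_gt0 addn_gt0 orbT.
(* The closed neighbourhoods have total size at most [n + 2 * num_edges e], hence at most
   [2 * N]. *)
have sumball : \sum_u #|ball near u| <= 2 * (81 * 2) * N.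
  apply: leq_trans (sum_ball near_sym near_cell card_cell) _.
  have -> : \sum_u #|closed_nbhd e u| = \sum_u (size (adj u) + 1).
    apply: eq_bigr => u _; have [uu mu] := adjP u.
    have un : u \notin adj u by rewrite mu -topredE /= e_irr.
    have /card_uniqP : uniq (u :: adj u) by rewrite /= un uu.
    rewrite addn1 => /= <-; apply: eq_card => v.
    by rewrite inE in_cons /nbc eq_sym mu.
  rewrite sumD; move: deg2; rewrite /N; set y := \sum_u _; lia.
have sweepT : sweep_time near + 1 <= (exchange_time * (2 * (81 * 2)) + 6) * N.
  rewrite /sweep_time sumD -big_distrr /= mulnDl -mulnA.
  have : exchange_time * \sum_u #|ball near u| <= exchange_time * (2 * (81 * 2) * N).
    by rewrite leq_mul2l sumball orbT.
  rewrite /N; set y := exchange_time * _; set z := exchange_time * _.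
  by lia.
have [t [s [ex [ht [D [out iD cD pr]]]]]] :
    run bound (dominating_set_prog sweep_count) (initial_state adj)
      (fun t s => t <= bound /\ exists D, [/\ outputs s D, indep e D, covers e D &
         progress e sweep_count D]).
  apply: run_seq; apply: (run_setup (e := e) W_large) => s1 es1 rs1 r22.
  apply: run_seq; apply: (run_initial W_large e_sym e_irr adjP es1 rs1).
  move=> t2 s2 D2 ht2 es2 rs2 iD2 cD2 r22'.
  apply: run_seq.
  apply: (run_sweeps W_large e_sym e_irr adjP I5 near3 near81 T_word (D := D2) (s := s2)) => //.
  - by move=> t D0 D'; apply: (progressS e_sym I5 I35 near_sym near_cell card_cell).
  - exact: (progress0 e_sym I5).
  - by rewrite r22'.
  move=> t3 s3 D3 ht3 es3 rs3 iD3 cD3 pr3.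
  apply: (run_output W_large es3 rs3) => t4 s4 ht4 out4; split; last by exists D3.
  have h2 : t2 <= 50 * N.
    apply: leq_trans ht2 _; rewrite sumD -big_distrr /=; move: deg2.
    by rewrite /N; set y := \sum_u _; lia.
  have h3 : t3 <= sweep_count * (exchange_time * (2 * (81 * 2)) + 6) * N + 2.
    by apply: leq_trans ht3 _; rewrite leq_add2r -mulnA leq_mul2l sweepT orbT.
  have h4 : t4 <= 14 * N by apply: leq_trans ht4 _; rewrite /N; lia.
  apply: (@leq_trans (sweep_count * (exchange_time * (2 * (81 * 2)) + 6) * N + 100 * N)).
    by move: h2 h3 h4; rewrite /N; set y := _ * _ * (n + _).+1; lia.
  rewrite /bound /time_factor mulnDl leq_add2r leq_mul2r leq_mul2l leq_add2l.
  by rewrite !orbT.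
exists t, s, D; split=> //; first exact/dominatingP.
by move=> S /dominatingP cS; apply: (progress_ratio pr cS).
Qed.

Theorem theorem1 :
  exists (p : prog) (c : nat),
    forall (R : realType) (n : nat) (e : rel 'I_n) (adj : 'I_n -> seq 'I_n),
      simple_graph e ->
      unit_disk_graph R e ->
      adjacency_lists e adj ->
      let bound := c * (n + num_edges e).+1 in
      exists (t : nat) (s : state) (D : {set 'I_n}),
        [/\ exec bound p (initial_state adj) t s,
            t <= bound,
            outputs s D,
            dominating e D
          & forall Dstar : {set 'I_n}, minimum_dominating e Dstar ->
              (#|D|%:R <= 44%:R / 9%:R * #|Dstar|%:R :> rat)%R].
Proof.
exists (dominating_set_prog sweep_count), time_factor => R n e adj sg ud adjP.
have [t [s [D [h1 h2 h3 h4 h5]]]] := dominating_set_prog_correct sg ud adjP.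
exists t, s, D; split; [exact: h1 | exact: h2 | exact: h3 | exact: h4 |].
move=> S [/h5 h _].
have : ((9 * #|D|)%:R <= (44 * #|S|)%:R :> rat)%R by rewrite Num.Theory.ler_nat.
by rewrite !GRing.natrM; lra.
Qed.
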